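(* Let $p$ be a prime, let $G$ be a non-trivial finite $p$-group and let $k$ be a field of characteristic $p$. The following statements are equivalent. (1) $G$ is isomorphic to $C_2$ or $C_3$. (2$'$) There are no non-trivial dual ghosts in $\mathrm{stmod}(kG)$. (3$'$) There are no non-trivial dual ghosts in $\mathrm{StMod}(kG)$. (4$'$) $\mathrm{stmod}(kG)$ is equivalent to its full subcategory consisting of the finite products of suspensions of $k$ (that is, every object of $\mathrm{stmod}(kG)$ is isomorphic in $\mathrm{stmod}(kG)$ to a finite product of suspensions of $k$). (5$'$) $\mathrm{StMod}(kG)$ is equivalent to its full subcategory consisting of retracts of arbitrary products of suspensions of $k$ (that is, every object of $\mathrm{StMod}(kG)$ is a retract in $\mathrm{StMod}(kG)$ of a product of suspensions of $k$).
   Context: All modules are left modules. $C_n$ denotes the cyclic group of order $n$. For a finite group $G$ and a field $k$ whose characteristic divides $|G|$, the stable module category $\mathrm{StMod}(kG)$ has as objects the $kG$-modules, and its morphism spaces are $\underline{\mathrm{Hom}}_{kG}(M,N)$, the $k$-vector space of $kG$-module homomorphisms $M\to N$ modulo those that factor through a projective $kG$-module. $\mathrm{stmod}(kG)$ is the category defined in the same way using only finite-dimensional $kG$-modules. $\Omega M$ denotes the kernel of a surjection from a projective module onto $M$; $\Omega$ is a self-equivalence of the stable category (the desuspension), so $\Omega^i$ is defined for all $i\in\mathbb{Z}$. The ''suspensions of $k$'' are the objects $\Omega^i k$, $i\in\mathbb{Z}$, where $k$ is the trivial $kG$-module. Products in $\mathrm{StMod}(kG)$ are given by products of modules. A map is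 ''trivial'' if it is zero in the stable category, i.e. factors through a projective. A map $d\colon M\to N$ between $kG$-modules is a ''dual ghost'' if the induced map $\underline{\mathrm{Hom}}_{kG}(N,\Omega^i k)\to\underline{\mathrm{Hom}}_{kG}(M,\Omega^i k)$ is zero for every $i\in\mathbb{Z}$. *)

(* Defs.v *)
(* MathComp; [boolp] is used only for the choice structure on an arbitrary
   product of modules. *)
From HB Require Import structures.
From mathcomp Require Import all_boot all_order all_algebra.
From mathcomp Require Import all_fingroup all_solvable.
From mathcomp Require Import boolp.

Set Implicit Arguments.
Unset Strict Implicit.
Unset Printing Implicit Defensive.

Import GRing.Theory.
Local Open Scope ring_scope.

(* The group algebra kG: functions G -> k with the convolution product, the
   group element g being the indicator function of {g}.  (MathComp's own
   product on finite functions is pointwise, hence the alias; the values are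
   taken in k^o so as to inherit the k-module structure of {ffun _ -> _}.)
   Left kG-modules are then the inhabitants of [lmodType (group_algebra k gT)]
   and kG-homomorphisms those of [{linear M -> N}]. *)
Definition group_algebra (k : fieldType) (gT : finGroupType) : Type :=
  {ffun gT -> k^o}.

Section GroupAlgebra.
Variables (k : fieldType) (gT : finGroupType).
Local Notation kG := (group_algebra k gT).

HB.instance Definition _ := GRing.Lmodule.copy kG {ffun gT -> k^o}.

Definition group_algebra_one : kG := [ffun x => (x == 1%g)%:R].

Definition group_algebra_mul (a b : kG) : kG :=
  [ffun x => \sum_(y : gT) (a y : k) * b (y^-1 * x)%g].

Let one := group_algebra_one.
Let mul := group_algebra_mul.

Let mulA : associative mul.
Proof.
move=> a b c; apply/ffunP => x; rewrite !ffunE.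
under eq_bigr => y _ do rewrite ffunE mulr_sumr.
under [RHS]eq_bigr => y _ do rewrite ffunE mulr_suml.
rewrite [RHS]exchange_big /=; apply: eq_bigr => y _.
rewrite [RHS](reindex_inj (mulgI y)) /=; apply: eq_bigr => z _.
by rewrite mulKg invMg mulgA mulrA.
Qed.

Let mul1 : left_id one mul.
Proof.
move=> a; apply/ffunP => x; rewrite ffunE (bigD1 1%g) //= ffunE eqxx mul1r.
rewrite invg1 mul1g big1 ?addr0 // => y ny1.
by rewrite ffunE (negbTE ny1) mul0r.
Qed.

Let mulr1 : right_id one mul.
Proof.
move=> a; apply/ffunP => x; rewrite ffunE (bigD1 x) //= ffunE mulVg eqxx mulr1.
rewrite big1 ?addr0 // => y nyx; rewrite ffunE.
by rewrite -eq_mulVg1 (negbTE nyx) mulr0.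
Qed.

Let mulDl : left_distributive mul +%R.
Proof.
move=> a b c; apply/ffunP => x; rewrite !ffunE -big_split /=.
by apply: eq_bigr => y _; rewrite ffunE mulrDl.
Qed.

Let mulDr : right_distributive mul +%R.
Proof.
move=> a b c; apply/ffunP => x; rewrite !ffunE -big_split /=.
by apply: eq_bigr => y _; rewrite ffunE mulrDr.
Qed.

Let one_neq0 : one != 0.
Proof.
apply/eqP => /ffunP/(_ 1%g)/eqP; rewrite !ffunE eqxx.
by rewrite (oner_eq0 k).
Qed.

HB.instance Definition _ :=
  GRing.Zmodule_isNzRing.Build kG mulA mul1 mulr1 mulDl mulDr one_neq0.

Let scaleAl (c : k) (a b : kG) : c *: (a * b) = c *: a * b.
Proof.
apply/ffunP => x; rewrite !ffunE scaler_sumr; apply: eq_bigr => y _.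
by rewrite ffunE; exact: mulrA.
Qed.

HB.instance Definition _ := GRing.Lmodule_isLalgebra.Build k kG scaleAl.

Let scaleAr (c : k) (a b : kG) : c *: (a * b) = a * (c *: b).
Proof.
apply/ffunP => x; rewrite !ffunE scaler_sumr; apply: eq_bigr => y _.
by rewrite ffunE; exact: mulrCA.
Qed.

HB.instance Definition _ := GRing.Lalgebra_isAlgebra.Build k kG scaleAr.

End GroupAlgebra.

(* The trivial kG-module k: every group element acts as the identity, so an
   element of kG acts through the sum of its coefficients. *)
Definition trivial_module (k : fieldType) (gT : finGroupType) : Type := k.

Section TrivialModule.
Variables (k : fieldType) (gT : finGroupType).
Local Notation kG := (group_algebra k gT).
Local Notation triv := (trivial_module k gT).

HB.instance Definition _ := GRing.Zmodule.copy triv k.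

Definition augmentation (a : kG) : k := \sum_(g : gT) a g.

Let scale (a : kG) (x : triv) : triv := augmentation a * (x : k).

Let scaleA a b x : scale a (scale b x) = scale (a * b) x.
Proof.
rewrite /scale mulrA; congr (_ * _); rewrite /augmentation mulr_suml.
under [RHS]eq_bigr => x' _ do rewrite ffunE.
rewrite [RHS]exchange_big /=; apply: eq_bigr => y _.
rewrite [RHS](reindex_inj (mulgI y)) mulr_sumr; apply: eq_bigr => z _.
by rewrite mulKg.
Qed.

Let scale1 : left_id 1 scale.
Proof.
move=> x; rewrite /scale /augmentation (bigD1 1%g) //= ffunE eqxx.
rewrite big1 ?addr0 ?mul1r // => y ny1.
by rewrite ffunE (negbTE ny1).
Qed.

Let scaleDr : right_distributive scale +%R.
Proof. by move=> a x y; exact: mulrDr. Qed.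

Let scaleDl x : {morph scale^~ x : a b / a + b}.
Proof.
move=> a b; rewrite /scale -mulrDl; congr (_ * _).
by rewrite /augmentation -big_split; apply: eq_bigr => g _; rewrite ffunE.
Qed.

HB.instance Definition _ :=
  GRing.Zmodule_isLmodule.Build kG triv scaleA scale1 scaleDr scaleDl.

End TrivialModule.

Definition product_module (R : pzRingType) (I : Type) (X : I -> lmodType R) :
  Type := forall i, X i.

Section ProductModule.
Variables (R : pzRingType) (I : Type) (X : I -> lmodType R).
Local Notation prodX := (product_module X).

HB.instance Definition _ := Choice.copy prodX (forall i, X i).

Let add (x y : prodX) : prodX := fun i => x i + y i.
Let opp (x : prodX) : prodX := fun i => - x i.
Let zero : prodX := fun i => 0.
Let scale (a : R) (x : prodX) : prodX := fun i => a *: x i.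

Let addA : associative add.
Proof. by move=> x y z; apply: functional_extensionality_dep => i; exact: addrA. Qed.
Let addC : commutative add.
Proof. by move=> x y; apply: functional_extensionality_dep => i; exact: addrC. Qed.
Let add0 : left_id zero add.
Proof. by move=> x; apply: functional_extensionality_dep => i; exact: add0r. Qed.
Let addN : left_inverse zero opp add.
Proof. by move=> x; apply: functional_extensionality_dep => i; exact: addNr. Qed.

HB.instance Definition _ := GRing.isZmodule.Build prodX addA addC add0 addN.

Let scaleA a b x : scale a (scale b x) = scale (a * b) x.
Proof. by apply: functional_extensionality_dep => i; exact: scalerA. Qed.
Let scale1 : left_id 1 scale.
Proof. by move=> x; apply: functional_extensionality_dep => i; exact: scale1r. Qed.
Let scaleDr : right_distributive scale +%R.
Proof. by move=> a x y; apply: functional_extensionality_dep => i; exact: scalerDr. Qed.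
Let scaleDl x : {morph scale^~ x : a b / a + b}.
Proof. by move=> a b; apply: functional_extensionality_dep => i; exact: scalerDl. Qed.

HB.instance Definition _ :=
  GRing.Zmodule_isLmodule.Build R prodX scaleA scale1 scaleDr scaleDl.

End ProductModule.

Definition projective (R : pzRingType) (P : lmodType R) : Prop :=
  forall (M N : lmodType R) (q : {linear M -> N}) (f : {linear P -> N}),
    (forall y, exists x, q x = y) ->
    exists g : {linear P -> M}, forall x, q (g x) = f x.

(* The stable category is taken over a class C of R-modules: all of them for
   StMod, the finite-dimensional ones for stmod.  A morphism of the stable
   category is represented by a linear map, and equality of morphisms is
   [stable_eq]; thus a hom-set of the category is {linear M -> N} modulo
   [stable_eq]. *)
Section StableCategory.
Variables (R : pzRingType) (C : lmodType R -> Prop).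
Implicit Types M N X Y K P : lmodType R.

Definition stably_trivial M N (f : M -> N) : Prop :=
  exists (P : lmodType R) (u : {linear M -> P}) (v : {linear P -> N}),
    [/\ C P, projective P & forall x, f x = v (u x)].

Definition stable_eq M N (f g : M -> N) : Prop :=
  stably_trivial (fun x => f x - g x).

Definition stable_iso M N : Prop :=
  exists (f : {linear M -> N}) (g : {linear N -> M}),
    stable_eq (g \o f) idfun /\ stable_eq (f \o g) idfun.

Definition stable_retract M N : Prop :=
  exists (s : {linear M -> N}) (r : {linear N -> M}), stable_eq (r \o s) idfun.

(* K is the kernel of a surjection from a projective module of C onto M. *)
Definition is_syzygy K M : Prop :=
  exists (P : lmodType R) (q : {linear P -> M}) (j : {linear K -> P}),
    [/\ C P, projective P, forall y, exists x, q x = y, injective j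
      & forall x, q x = 0 <-> exists y, j y = x].

(* X is isomorphic, in the stable category, to the n-th iterate of Omega on M.
   Omega is only determined up to isomorphism in that category. *)
Fixpoint is_Omega_iter (n : nat) M X : Prop :=
  if n is n'.+1 then
    exists Y K, [/\ C Y, C K, is_Omega_iter n' M Y, is_syzygy K Y
                  & stable_iso X K]
  else stable_iso X M.

(* For i < 0, Omega being a self-equivalence of the stable category,
   Omega^i M is the object X, unique up to isomorphism, such that
   Omega^(-i) X is isomorphic to M. *)
Definition is_Omega_pow (i : int) M X : Prop :=
  match i with
  | Posz n => is_Omega_iter n M X
  | Negz n => is_Omega_iter n.+1 X M
  end.

End StableCategory.

Section GroupModules.
Variables (k : fieldType) (gT : finGroupType).
Local Notation kG := (group_algebra k gT).

Definition all_modules (M : lmodType kG) : Prop := True.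

(* k acts on a kG-module through the scalars c%:A of kG. *)
Definition finite_dimensional (M : lmodType kG) : Prop :=
  exists (n : nat) (e : 'I_n -> M), forall x : M,
    exists c : 'I_n -> k, x = \sum_(i < n) ((c i)%:A : kG) *: e i.

Variable C : lmodType kG -> Prop.

Definition is_Omega_k (i : int) (X : lmodType kG) : Prop :=
  C X /\ is_Omega_pow C i (trivial_module k gT) X.

Definition is_suspension_of_k (X : lmodType kG) : Prop :=
  exists i : int, is_Omega_k i X.

Definition dual_ghost (M N : lmodType kG) (d : {linear M -> N}) : Prop :=
  forall (i : int) (X : lmodType kG), is_Omega_k i X ->
    forall f : {linear N -> X}, stably_trivial C (f \o d).

Definition no_nontrivial_dual_ghosts : Prop :=
  forall M N : lmodType kG, C M -> C N ->
    forall d : {linear M -> N}, dual_ghost d -> stably_trivial C d.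

Definition finite_products_of_suspensions : Prop :=
  forall M : lmodType kG, C M ->
    exists (n : nat) (X : 'I_n -> lmodType kG),
      (forall i, is_suspension_of_k (X i)) /\
      stable_iso C M (product_module X).

Definition retracts_of_products_of_suspensions : Prop :=
  forall M : lmodType kG, C M ->
    exists (I : Type) (X : I -> lmodType kG),
      (forall i, is_suspension_of_k (X i)) /\
      stable_retract C M (product_module X).

End GroupModules.

Arguments all_modules {k gT}.
Arguments finite_dimensional {k gT}.

(* Main.v *)
Require Import Defs.
From HB Require Import structures.
From mathcomp Require Import all_boot all_order all_algebra.
From mathcomp Require Import all_fingroup all_solvable.
From mathcomp Require Import boolp classical_sets zify.

(* Let x be central of order p and t = x - 1, so that t^p = 0 and, on every
   projective kG-module, ker t^m = im t^(p-m).  Let b in kG have augmentation 0.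
   The property "b maps ker t^m into im t^(p-m) for all m <= p" holds trivially
   for k and is inherited along syzygies, cosyzygies, products and stable
   retracts, hence holds for every stable retract of a product of suspensions
   of k.  It fails for D_m = ker t^m in kG as soon as 2m <= p and b is not in
   t^m kG, and for the same reason right multiplication by b on D_m is then a
   non-trivial dual ghost.  If G is not <x>, take m = 1 and b = g - 1 with g
   outside <x>; if |G| = p >= 5, take m = 2 and b = t.

   Conversely, for G = <x> the algebra is k[t]/t^p, and every module is a free
   module plus copies of D_1, ..., D_(p-1) (finitely many, when it is finite-
   dimensional; in general a retract of a product of such).  When p <= 3 these
   are D_1 = k and D_(p-1) = Omega k.  Dual ghosts into a retract of a product
   of suspensions vanish because a map is stably trivial if and only if it is
   the trace over G of a k-linear map, a condition that can be checked
   componentwise on a product. *)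

Set Implicit Arguments.
Unset Strict Implicit.
Unset Printing Implicit Defensive.

Import GRing.Theory.
Local Open Scope ring_scope.

(** * Generalized inverses of linear maps *)

Definition mk_linear (R : pzRingType) (U V : lmodType R) (f : U -> V)
    (f_lin : linear f) : {linear U -> V} :=
  HB.pack f (GRing.isLinear.Build R U V *:%R f f_lin).

Section GeneralizedInverse.
Variables (k : fieldType) (V W : lmodType k) (f : {linear V -> W}).

(* Zorn on the partial inverses of f: graphs of linear maps v = g w defined on
   a subspace of W with f (g w) = w whenever w is in the image of f. *)
Let partial_inverse (A : set (W * V)) : Prop :=
  [/\ forall c x y, A x -> A y -> A (c *: x + y),
      forall v, A (0, v) -> v = 0
    & forall w v, A (w, v) -> (exists u, f u = w) -> f v = w].

Lemma generalized_inverse :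
  exists g : {linear W -> V}, forall v, f (g (f v)) = f v.
Proof.
have [F FP Ftot|A [[Alin A0 Af] Amax]] := @Zorn_bigcup _ partial_inverse.
  split.
  - move=> c x y [X FX Xx] [Y FY Yy].
    have [/(_ _ Xx) Yx|/(_ _ Yy) Xy] := Ftot _ _ FX FY.
      by exists Y => //; have [+ _ _] := FP _ FY; apply.
    by exists X => //; have [+ _ _] := FP _ FX; apply.
  - by move=> v [X FX]; have [_ + _] := FP _ FX; apply.
  - by move=> w v [X FX]; have [_ _ +] := FP _ FX; apply.
(* Every non-empty partial inverse contains (0, 0), and a maximal one is non-empty because the graph
   {(0, 0)} properly contains the empty one. *)
have A00 : A (0, 0).
  apply: contrapT => nA0; apply: (Amax [set (0, 0)]%classic).
    split=> [[w v] Awv|/(_ (0, 0) erefl)//].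
    by case: nA0; have := Alin (-1) _ _ Awv Awv; rewrite scaleN1r addNr.
  split.
  - by move=> c x y -> ->; congr (_, _); rewrite scaler0 addr0.
  - by move=> v [].
  - by move=> w v [-> ->] _; rewrite linear0.
(* By maximality a pair with w1 outside the domain cannot be adjoined, so the inverse condition must
   fail on the enlarged graph. *)
have extend w1 v1 : (forall v, ~ A (w1, v)) ->
    ~ (forall c a v, A (a, v) -> (exists u, f u = c *: w1 + a) ->
       f (c *: v1 + v) = c *: w1 + a).
  move=> ndom ok.
  apply: (Amax [set x | exists c y, A y /\ x = c *: (w1, v1) + y]%classic).
    split=> [y Ay|sub].
      by exists 0, y; rewrite scale0r add0r.
    apply: (ndom v1); apply: sub; exists 1, (0, 0); split=> //.
    by rewrite scale1r addr0.
  split.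
  - move=> c _ _ [a [x [Ax ->]]] [b [y [Ay ->]]].
    exists (c * a + b), (c *: x + y); split; first exact: Alin.
    by rewrite scalerDl scalerDr scalerA addrACA.
  - move=> v [c [[a u] [Aau [ea ->]]]].
    have [c0|c0] := eqVneq c 0.
      move: ea Aau; rewrite c0 !scale0r !add0r => <- Au.
      exact: A0.
    case: (ndom (- c^-1 *: u)).
    suff -> : w1 = - c^-1 *: a.
      by have := Alin (- c^-1) _ _ Aau A00; rewrite addr0.
    apply: (scalerI c0); rewrite scalerA mulrN divff // scaleN1r.
    by apply/eqP; rewrite -addr_eq0 -ea.
  - move=> w v [c [[a u] [Aau [-> ->]]]]; exact: ok.
have total w : exists v, A (w, v).
  apply: contrapT => /forallNP ndom.
  (* If w + a is in the image of f for some a in the domain, adjoin w + a with a preimage. Otherwise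
     no c w + a with c nonzero is in the image, and w may be sent to 0. *)
  have [[a [v [u [Aav eu]]]]|none] :=
      pselect (exists a v u, A (a, v) /\ f u = w + a).
    apply: (extend (w + a) u).
      move=> v' Av'; apply: (ndom (v' - v)).
      have -> : (w, v' - v) = -1 *: (a, v) + (w + a, v').
        by congr (_, _); rewrite scaleN1r addrC ?addrK.
      exact: Alin.
    move=> c b v' Abv' [u' eu'].
    have fv' : f v' = b.
      apply: Af Abv' _; exists (u' - c *: u).
      by rewrite linearB linearZ /= eu' eu addrAC subrr add0r.
    by rewrite linearD linearZ /= eu fv'.
  apply: (extend w 0 ndom) => c a v Aav [u eu].
  have [c0|c0] := eqVneq c 0.
    move: eu; rewrite c0 !scale0r !add0r => eu.
    by apply: Af Aav _; exists u.
  case: none; exists (c^-1 *: a), (c^-1 *: v), (c^-1 *: u); split.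
    by have := Alin c^-1 _ _ Aav A00; rewrite addr0.
  by rewrite linearZ /= eu scalerDr scalerA mulVf // scale1r.
have [g gA] := choice total.
have uniq w v : A (w, v) -> v = g w.
  move=> Awv; apply/eqP; rewrite -subr_eq0; apply/eqP/A0.
  have -> : (0, v - g w) = -1 *: (w, g w) + (w, v).
    by congr (_, _); rewrite scaleN1r ?addNr // addrC.
  exact: Alin.
have g_lin : linear g.
  by move=> c x y; apply/esym/uniq/(Alin c _ _ (gA x) (gA y)).
exists (mk_linear g_lin) => v.
by apply: (Af _ _ (gA (f v))); exists v.
Qed.

End GeneralizedInverse.

(** * Projective kG-modules and relative traces *)

Section GroupElements.
Variables (k : fieldType) (gT : finGroupType).
Local Notation kG := (group_algebra k gT).

Definition group_element (g : gT) : kG := [ffun y => (y == g)%:R].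
Local Notation "g %:e" := (group_element g) (at level 2, format "g %:e").

Lemma group_elementM g h : (g * h)%g%:e = g%:e * h%:e.
Proof.
apply/ffunP => y; rewrite !ffunE (bigD1 g) //= !ffunE eqxx mul1r.
rewrite big1 ?addr0 => [|z /negbTE nz]; last by rewrite ffunE nz mul0r.
by rewrite -(inj_eq (mulgI g) (g^-1 * y)%g) mulKVg.
Qed.

Lemma group_element1 : 1%g%:e = 1 :> kG.
Proof. by apply/ffunP => y; rewrite !ffunE. Qed.

Lemma group_elementX g n : (g ^+ n)%g%:e = g%:e ^+ n.
Proof.
elim: n => [|n IHn]; first by rewrite expr0 group_element1.
by rewrite expgS group_elementM IHn exprS.
Qed.

Lemma group_algebra_sum (a : kG) : a = \sum_g a g *: g%:e.
Proof.
apply/ffunP => y; rewrite sum_ffunE (bigD1 y) //= !ffunE eqxx.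
rewrite big1 => [|z nz]; first by rewrite addr0; exact/esym/mulr1.
by rewrite !ffunE eq_sym (negbTE nz); exact: mulr0.
Qed.

Lemma group_element_central x : x \in 'C([set: gT])%g ->
  forall a : kG, a * x%:e = x%:e * a.
Proof.
move=> /centP xC a; rewrite [a in LHS]group_algebra_sum [a in
  RHS]group_algebra_sum.
rewrite mulr_suml mulr_sumr; apply: eq_bigr => g _.
rewrite -scalerAl -scalerAr -!group_elementM.
by rewrite (xC g) ?inE.
Qed.

End GroupElements.

Notation "g %:e" := (group_element _ g) (at level 2, format "g %:e").

Section ScalarRestriction.
Variables (k : fieldType) (gT : finGroupType).
Local Notation kG := (group_algebra k gT).

(** An alias, so that the k-scaling on the carrier does not compete with the kG-scaling of [M]. *)
Definition kspace (M : lmodType kG) : Type := M.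

Section Instance.
Variable M : lmodType kG.

HB.instance Definition _ := GRing.Zmodule.copy (kspace M) M.

Let scale (c : k) (x : kspace M) : kspace M := (c%:A : kG) *: (x : M).

Let scaleA a b x : scale a (scale b x) = scale (a * b) x.
Proof. by rewrite /scale scalerA -scalerAl mul1r scalerA. Qed.
Let scale1 : left_id 1 scale.
Proof. by move=> x; rewrite /scale !scale1r. Qed.
Let scaleDr : right_distributive scale +%R.
Proof. by move=> a x y; exact: scalerDr. Qed.
Let scaleDl x : {morph scale^~ x : a b / a + b}.
Proof. by move=> a b; rewrite /scale !scalerDl. Qed.

HB.instance Definition _ :=
  GRing.Zmodule_isLmodule.Build k (kspace M) scaleA scale1 scaleDr scaleDl.

Lemma kspaceZ (c : k) (x : kspace M) : c *: x = (c%:A : kG) *: (x : M).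
Proof. by []. Qed.

End Instance.

Lemma algebra_scalar_comm (c : k) (a : kG) : a * c%:A = c%:A * a.
Proof. by rewrite -scalerAr mulr1 -scalerAl mul1r. Qed.

Lemma kspace_linear (M N : lmodType kG) (f : {linear M -> N}) :
  linear (f : kspace M -> kspace N).
Proof. by move=> c x y; rewrite !kspaceZ linearP. Qed.

Definition klin (M N : lmodType kG) (f : {linear M -> N}) :=
  mk_linear (kspace_linear f).

Lemma kspace_scale_linear (M : lmodType kG) (a : kG) :
  linear (fun x : kspace M => a *: (x : M) : kspace M).
Proof.
move=> c x y; rewrite !kspaceZ scalerDr !scalerA.
by rewrite algebra_scalar_comm.
Qed.

Definition kscale (M : lmodType kG) (a : kG) := mk_linear (@kspace_scale_linear
  M a).

Section KLinear.
Variables (M N : lmodType kG) (h : {linear kspace M -> kspace N}).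

Lemma klinZ (c : k) (y : M) : h ((c%:A : kG) *: y) = (c%:A : kG) *: (h y : N).
Proof. exact: (linearZ_LR h). Qed.

Lemma klinD (x y : M) : h (x + y) = (h x : N) + h y.
Proof. exact: (linearD h). Qed.

Lemma klinB (x y : M) : h (x - y) = (h x : N) - h y.
Proof. exact: (linearB h). Qed.

Lemma klin0 : h (0 : M) = (0 : N).
Proof. exact: (linear0 h). Qed.

Lemma klin_sum I (r : seq I) (P : pred I) (E : I -> M) :
  h (\sum_(i <- r | P i) E i) = \sum_(i <- r | P i) (h (E i) : N).
Proof. exact: (linear_sum h). Qed.

End KLinear.

Lemma linear_group_elements (M N : lmodType kG) (f : kspace M -> kspace N) :
  linear f -> (forall (g : gT) (y : M), f (g%:e *: y) = g%:e *: (f y : N)) ->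
  linear (f : M -> N).
Proof.
move=> fl fG; set F := mk_linear fl.
have fD x y : f (x + y) = f x + f y by rewrite -[f]/(F : _ -> _) linearD.
move=> a x y; rewrite fD; congr (_ + _).
rewrite (group_algebra_sum a) !scaler_suml.
rewrite (big_morph f fD (linear0 F)); apply: eq_bigr => g _.
rewrite -[a g *: g%:e]mul1r -scalerAr scalerAl -!scalerA -fG.
exact: (linearZ_LR F).

Qed.

End ScalarRestriction.

(** * Free modules induced from k-spaces *)

Section FreeModule.
Variables (k : fieldType) (gT : finGroupType).
Local Notation kG := (group_algebra k gT).

(* kG (x) M, the function f standing for the sum of the g (x) f g: a free
   kG-module since M is free over k. *)
Definition free_module (M : lmodType kG) : Type := {ffun gT -> M}.

Section Instance.
Variable M : lmodType kG.
Local Notation F := (free_module M).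

HB.instance Definition _ := GRing.Zmodule.copy F {ffun gT -> M}.

Let scale (a : kG) (f : F) : F :=
  [ffun y : gT => \sum_g ((a g : k)%:A : kG) *: f (g^-1 * y)%g].

Let scaleA a b f : scale a (scale b f) = scale (a * b) f.
Proof.
apply/ffunP => y; rewrite !ffunE.
under eq_bigr => g _ do rewrite ffunE scaler_sumr.
under [RHS]eq_bigr => g _ do rewrite ffunE !scaler_suml.
rewrite [RHS]exchange_big /=; apply: eq_bigr => g _.
rewrite [RHS](reindex_inj (mulgI g)) /=; apply: eq_bigr => h _.
by rewrite mulKg invMg mulgA scalerA -scalerAl mul1r scalerA.
Qed.
Let scale1 : left_id 1 scale.
Proof.
move=> f; apply/ffunP => y; rewrite ffunE (bigD1 1%g) //= ffunE eqxx.
rewrite invg1 mul1g !scale1r big1 ?addr0 // => g ng.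
by rewrite ffunE (negbTE ng) !scale0r.
Qed.
Let scaleDr : right_distributive scale +%R.
Proof.
move=> a f f'; apply/ffunP => y; rewrite !ffunE -big_split /=.
by apply: eq_bigr => g _; rewrite ffunE scalerDr.
Qed.
Let scaleDl f : {morph scale^~ f : a b / a + b}.
Proof.
move=> a b; apply/ffunP => y; rewrite !ffunE -big_split /=.
by apply: eq_bigr => g _; rewrite ffunE !scalerDl.
Qed.

HB.instance Definition _ :=
  GRing.Zmodule_isLmodule.Build kG F scaleA scale1 scaleDr scaleDl.

Lemma free_moduleZ (a : kG) (f : F) y :
  (a *: f) y = \sum_g ((a g : k)%:A : kG) *: f (g^-1 * y)%g.
Proof. by rewrite ffunE. Qed.

Lemma free_moduleGZ g (f : F) y : (g%:e *: f) y = f (g^-1 * y)%g.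
Proof.
rewrite free_moduleZ (bigD1 g) //= ffunE eqxx !scale1r big1 ?addr0 // => h nh.
by rewrite ffunE (negbTE nh) !scale0r.
Qed.

Lemma free_moduleDE (f f' : F) y : (f + f') y = f y + f' y.
Proof. by rewrite ffunE. Qed.

Lemma free_modulekZ (c : k) (f : F) y : ((c%:A : kG) *: f) y = (c%:A : kG) *: f
  y.
Proof.
rewrite free_moduleZ (bigD1 1%g) //= !ffunE eqxx invg1 mul1g big1 ?addr0.
  by congr (_%:A *: _); exact: mulr1.
by move=> g ng; rewrite !ffunE (negbTE ng) scaler0 !scale0r.
Qed.

Definition free_delta (y : M) : F := [ffun g => if g == 1%g then y else 0].

Lemma free_delta_linear : linear (free_delta : kspace M -> kspace F).
Proof.
move=> c x y; apply/ffunP => g; rewrite kspaceZ [RHS]free_moduleDE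
  free_modulekZ !ffunE.
by case: (g == _) => //; rewrite scaler0 addr0.
Qed.

Lemma free_module_sum (f : F) : f = \sum_g g%:e *: free_delta (f g).
Proof.
apply/ffunP => y; rewrite sum_ffunE (bigD1 y) //= free_moduleGZ ffunE mulVg
  eqxx.
rewrite big1 ?addr0 // => g ng; rewrite free_moduleGZ ffunE -eq_mulVg1.
by rewrite (negbTE ng).
Qed.

End Instance.

Section Extension.
Variables (M N : lmodType kG) (h : {linear kspace M -> kspace N}).
Local Notation F := (free_module M).

(** The universal property of the free module: the kG-linear extension of [h] from the generators
    [free_delta y]. *)
Definition free_lift (f : F) : N := \sum_g g%:e *: (h (f g) : N).

Lemma free_lift_linear : linear free_lift.
Proof.
apply: linear_group_elements => [c f f'|g f]; rewrite /free_lift.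
  rewrite [X in _ = X + _]kspaceZ scaler_sumr -big_split.
  apply: eq_bigr => g _.
  rewrite kspaceZ free_moduleDE free_modulekZ.
  by rewrite klinD klinZ scalerDr !scalerA algebra_scalar_comm.
rewrite scaler_sumr (reindex_inj (mulgI g)); apply: eq_bigr => l _.
by rewrite free_moduleGZ mulKg scalerA -group_elementM.
Qed.

Lemma free_lift_delta y : free_lift (free_delta y) = h y.
Proof.
rewrite /free_lift (bigD1 1%g) //= ffunE eqxx group_element1 scale1r.
rewrite big1 ?addr0 // => g ng; rewrite ffunE (negbTE ng).
by rewrite [h 0](linear0 h) scaler0.
Qed.

End Extension.

(** A k-linear section of the surjection lifts the map on the generators [free_delta y], and
    [free_lift] extends this lift. *)
Lemma free_module_projective (M : lmodType kG) : projective (free_module M).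
Proof.
move=> A B q f qs.
have [s sq] := generalized_inverse (klin q).
have qsK y : q (s y) = y by have [x <-] := qs y; exact: sq.
pose s0 (y : kspace M) : kspace A := s (f (free_delta y)).
have s0_lin : linear s0.
  move=> c x y; rewrite /s0 -[RHS]linearP; congr (s _).
  by rewrite free_delta_linear; exact: (linearP f).
exists (mk_linear (free_lift_linear (mk_linear s0_lin))) => x.
rewrite [in RHS](free_module_sum x) /= /free_lift !linear_sum.
by apply: eq_bigr => g _; rewrite !linearZ /= /s0 qsK.
Qed.

Definition free_cover (M : lmodType kG) : {linear free_module M -> M} :=
  mk_linear (free_lift_linear (klin idfun)).

Lemma free_cover_section (P : lmodType kG) : projective P ->
  exists s : {linear P -> free_module P}, forall y, free_cover P (s y) = y.
Proof.
move=> prP; apply: (prP _ _ (free_cover P) idfun) => y.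
by exists (free_delta y); exact: free_lift_delta.
Qed.

Lemma group_algebra_projective : projective (kG^o : lmodType kG).
Proof.
move=> A B q f qs; have [m qm] := qs (f 1).
have g_lin : linear (fun a : kG^o => a *: m).
  by by move=> c x y; rewrite scalerDl scalerA.
exists (mk_linear g_lin) => a /=.
by rewrite linearZ /= qm -linearZ; congr (f _); exact: mulr1.
Qed.

End FreeModule.

(** * Higman's criterion: stably trivial maps as traces *)

Section TraceCriterion.
Variables (k : fieldType) (gT : finGroupType).
Local Notation kG := (group_algebra k gT).

(** The transfer from the trivial subgroup to G on Hom_k(M, N), with G acting by conjugation. *)
Definition relative_trace (M N : lmodType kG) (h : M -> N) (y : M) : N :=
  \sum_g g%:e *: h (g^-1%g%:e *: y).

(** A projective P is a retract of [free_module P], whose identity is the trace of the k-linear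
    projection onto the component at 1. Composing with kG-maps turns traces into traces. *)
Lemma stably_trivial_trace (C : lmodType kG ->
  Prop) (M N : lmodType kG) (f : M -> N) :
  stably_trivial C f ->
  exists h : {linear kspace M -> kspace N}, forall y, f y = relative_trace h y.
Proof.
move=> [P [u [v [_ prP fE]]]]; have [s sK] := free_cover_section prP.
have h_lin : linear (fun y : kspace M => v (s (u y) 1%g) : kspace N).
  move=> c x y; rewrite !kspaceZ !linearP /=.
  by rewrite free_moduleDE free_modulekZ linearP.
exists (mk_linear h_lin) => y; rewrite fE -(sK (u y)) /= /free_lift linear_sum.
apply: eq_bigr => g _; rewrite linearZ /=; congr (_ *: v _).
by rewrite !linearZ /= free_moduleGZ invgK mulg1.
Qed.

(** Sending y to the function g |-> g^-1 y is kG-linear into the free module on M, and following it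
    with [free_lift h] gives the trace of [h]. *)
Lemma trace_stably_trivial (C : lmodType kG -> Prop) (M N : lmodType kG)
    (f : M -> N) (h : {linear kspace M -> kspace N}) :
  C (free_module M) -> (forall y, f y = relative_trace h y) ->
    stably_trivial C f.
Proof.
move=> CF fE.
pose u (y : M) : free_module M := [ffun g => g^-1%g%:e *: y].
have u_lin : linear u.
  apply: linear_group_elements => [c x y|g y].
    apply/ffunP => g; rewrite !kspaceZ [RHS]free_moduleDE free_modulekZ !ffunE.
    by rewrite scalerDr !scalerA algebra_scalar_comm.
  apply/ffunP => l; rewrite free_moduleGZ !ffunE invMg invgK.
  by rewrite group_elementM scalerA.
exists (free_module M), (mk_linear u_lin), (mk_linear (free_lift_linear h)).
split=> // [|y]; first exact: free_module_projective.
by rewrite fE /= /free_lift; apply: eq_bigr => g _; rewrite ffunE.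
Qed.

End TraceCriterion.

(** * Exactness of projectives over a central subgroup of order p *)

Section Kernel.
Variables (R : pzRingType) (M N : lmodType R) (f : {linear M -> N}).

Definition kernel_pred := [pred x : M | f x == 0].

Fact kernel_submod_closed : submod_closed kernel_pred.
Proof.
split=> [|a x y]; rewrite !inE ?linear0 // => /eqP x0 /eqP y0.
by rewrite linearP x0 y0 scaler0 addr0.
Qed.

HB.instance Definition _ := GRing.isSubmodClosed.Build R M kernel_pred
  kernel_submod_closed.

Definition kernel_module : Type := {x : M | x \in kernel_pred}.
HB.instance Definition _ := [isSub of kernel_module for @sval _ _].
HB.instance Definition _ := [Choice of kernel_module by <:].
HB.instance Definition _ := [SubChoice_isSubLmodule of kernel_module by <:].

Definition kernel_val (x : kernel_module) : M := val x.

Lemma kernel_val_linear : linear kernel_val.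
Proof. exact: linearP. Qed.

Definition kernel_inj := mk_linear kernel_val_linear.

Lemma kernel_injP x : f (kernel_inj x) = 0.
Proof. exact/eqP/(valP x). Qed.

Lemma kernel_inj_injective : injective kernel_inj.
Proof. exact: val_inj. Qed.

Section Corestriction.
Variables (L : lmodType R) (h : {linear L -> M}) (fh : forall x, f (h x) = 0).

Definition kernel_corestrict (x : L) : kernel_module :=
  exist _ (h x) (introT eqP (fh x)).

Lemma kernel_corestrict_linear : linear kernel_corestrict.
Proof. by move=> a x y; apply: kernel_inj_injective; exact: (linearP h). Qed.

Definition kernel_lift := mk_linear kernel_corestrict_linear.

Lemma kernel_liftK x : kernel_inj (kernel_lift x) = h x.
Proof. by []. Qed.

End Corestriction.
End Kernel.

Section CentralScaling.
Variables (R : pzRingType) (M : lmodType R) (z : R).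
Hypothesis zC : forall a : R, a * z = z * a.

Lemma central_scale_linear : linear (fun y : M => z *: y).
Proof. by move=> a x y; rewrite scalerDr !scalerA zC. Qed.

Definition central_scale := mk_linear central_scale_linear.

End CentralScaling.

Section CentralElement.
Variables (p : nat) (k : fieldType) (gT : finGroupType) (x : gT).
Hypotheses (p_prime : prime p) (k_char : p \in [pchar k]).
Hypotheses (x_central : x \in 'C([set: gT])%g) (x_order : #[x]%g = p).
Local Notation kG := (group_algebra k gT).

Definition aug_elt : kG := x%:e - 1.
Local Notation t := aug_elt.

Lemma aug_elt_central n (a : kG) : a * t ^+ n = t ^+ n * a.
Proof.
apply: commrX; rewrite /GRing.comm mulrBr mulrBl mulr1 mul1r.
by rewrite group_element_central.
Qed.

(** Frobenius: (x - 1)^p = x^p - 1 in characteristic p. *)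
Lemma aug_eltXp : t ^+ p = 0.
Proof.
have cp : p \in [pchar kG] := rmorph_pchar (in_alg kG) k_char.
rewrite -(pFrobenius_autE cp) pFrobenius_autB_comm ?pFrobenius_aut1.
  by rewrite pFrobenius_autE -group_elementX -x_order expg_order group_element1
    subrr.
exact: commr1.
Qed.

Lemma aug_eltXp1 : t ^+ p.-1 = \sum_(i < p) (x ^+ i)%g%:e.
Proof.
(* The identity is proved in k[X], where X - 1 can be cancelled, and then evaluated at x; in kG the
   element x - 1 is a zero divisor. *)
have poly_eq : ('X - 1) ^+ p.-1 = \sum_(i < p) 'X^i :> {poly k}.
  have cp : p \in [pchar {poly k}] by rewrite pchar_poly.
  apply: (@mulfI _ ('X - 1 : {poly k}));
    first by rewrite -[1]/(1%:P) polyXsubC_eq0.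
  rewrite -exprS prednK ?prime_gt0 // -subrX1.
  by rewrite -(pFrobenius_autE cp) pFrobenius_autB_comm ?pFrobenius_aut1
    ?pFrobenius_autE //; exact: commr1.
have := congr1 (horner_alg (x%:e : kG)) poly_eq.
rewrite rmorphXn rmorphB rmorph1 rmorph_sum /= horner_algX => ->.
by apply: eq_bigr => i _; rewrite rmorphXn /= horner_algX group_elementX.
Qed.

(* t^(p-1) is the norm element of <x>, so an x-invariant f is t^(p-1) applied to
   the restriction of f to a transversal of the cosets of <x>. *)
Lemma free_module_exact (M : lmodType kG) (f : free_module M) :
  t *: f = 0 -> exists w, f = t ^+ p.-1 *: w.
Proof.
rewrite scalerBl scale1r => /eqP; rewrite subr_eq0 => /eqP xf.
have xif i : (x ^+ i)%g%:e *: f = f.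
  by elim: i => [|i IHi]; rewrite ?group_element1 ?scale1r // expgS
    group_elementM -scalerA IHi.
pose r g := repr (<[x]> :* g)%g.
pose w : free_module M := [ffun g => if g == r g then f g else 0].
exists w; apply/ffunP => g.
rewrite aug_eltXp1 scaler_suml sum_ffunE.
have rx i : r ((x ^+ i)^-1 * g)%g = r g.
  congr (repr _); rewrite rcosetM; congr (_ :* g)%g.
  by rewrite rcoset_id // groupV mem_cycle.
have /rcosetP [y yx ey] : r g \in (<[x]> :* g)%g by exact: (mem_repr g
  (rcoset_refl _ g)).
have [i lti yi] := cyclePmin (groupVr yx); rewrite x_order in lti.
(* Only the power x^i for which x^(-i) g is the coset representative contributes. *)
rewrite (bigD1 (Ordinal lti)) //= big1 ?addr0 => [|j nj].
  rewrite free_moduleGZ ffunE rx -yi invgK ey eqxx.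
  by rewrite -[in RHS](invgK y) yi -free_moduleGZ xif.
rewrite free_moduleGZ ffunE rx ey; case: eqP => // /mulIg ej.
have : (x ^+ j == x ^+ i)%g by rewrite -yi -ej invgK.
by rewrite eq_expg_mod_order x_order !modn_small // => /eqP ji; case/eqP: nj;
  apply: val_inj.
Qed.

(** The kernel of t is handled by passing to a free module of which P is a retract. In the
    induction, t^m y is killed by t, hence equals t^(p-1) w; subtracting t^(p-m-1) w from y leaves
    an element of ker t^m. *)
Lemma projective_exact (P : lmodType kG) m (y : P) : projective P ->
  (m <= p)%N ->
  t ^+ m *: y = 0 -> exists w, y = t ^+ (p - m) *: w.
Proof.
move=> prP; have [s sK] := free_cover_section prP.
elim: m y => [|m IHm] y ltmp; first by rewrite scale1r => ->; exists 0;
  rewrite scaler0.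
rewrite exprS -scalerA => ty.
have [w ew] : exists w, t ^+ m *: y = t ^+ p.-1 *: w.
  have [|w ew] := @free_module_exact _ (s (t ^+ m *: y)).
    by rewrite -linearZ ty linear0.
  by exists (free_cover P w); rewrite -linearZ -ew sK.
have [|v ev] := IHm (y - t ^+ (p - m.+1) *: w) (ltnW ltmp).
  rewrite scalerBr ew scalerA -exprD.
  by rewrite -[(m + _)%N]/(m.+1 + (p - m.+1)).-1 subnKC // subrr.
exists (w + t *: v); rewrite scalerDr scalerA -exprSr -subSn // subSS.
by rewrite -ev addrC subrK.
Qed.

Lemma group_algebra_exact m (a : kG) : (m <= p)%N ->
  t ^+ m * a = 0 -> exists w, a = t ^+ (p - m) * w.
Proof.
by move=> lemp ta; exact: (projective_exact (@group_algebra_projective k gT)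
  lemp ta).
Qed.

End CentralElement.

(** * Kernels and images of powers of x - 1 on suspensions of k *)

Section FiniteDimensional.
Variables (k : fieldType) (gT : finGroupType).
Local Notation kG := (group_algebra k gT).
Implicit Types M N : lmodType kG.

Lemma finite_dimensional_image M N (f : {linear M -> N}) :
  (forall y, exists x, f x = y) -> finite_dimensional M -> finite_dimensional N.
Proof.
move=> fs [n [e eM]]; exists n, (f \o e) => y; have [x <-] := fs y.
have [c ->] := eM x; exists c; rewrite linear_sum.
by apply: eq_bigr => i _; rewrite linearZ.
Qed.

Lemma finite_dimensional_finType M (I : finType) (e : I -> M) :
  (forall y, exists c : I -> k, y = \sum_i ((c i)%:A : kG) *: e i) ->
  finite_dimensional M.
Proof.
move=> eM; exists #|I|, (e \o enum_val) => y; have [c ->] := eM y.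
exists (c \o enum_val).
by rewrite (reindex _ (onW_bij _ (enum_val_bij I))).
Qed.

Lemma finite_dimensional_free M :
  finite_dimensional M -> finite_dimensional (free_module M).
Proof.
move=> [n [e eM]].
apply: (@finite_dimensional_finType _ (gT * 'I_n)%type
  (fun z => z.1%:e *: free_delta (e z.2))) => f.
have /choice [c cE] : forall g, exists c : 'I_n ->
  k, f g = \sum_i ((c i)%:A : kG) *: e i.
  by move=> g; exact: eM.
exists (fun z => c z.1 z.2).
rewrite [LHS]free_module_sum -(pair_bigA _ (fun g i =>
  ((c g i)%:A : kG) *: (g%:e *: free_delta (e i)))) /=.
apply: eq_bigr => g _; rewrite {1}cE.
pose d := mk_linear (@free_delta_linear _ _ M).
rewrite -[free_delta _]/(d _ : free_module M) klin_sum scaler_sumr.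
apply: eq_bigr => i _; rewrite klinZ !scalerA.
by rewrite algebra_scalar_comm.
Qed.

Lemma finite_dimensional_group_algebra : finite_dimensional (kG^o : lmodType
  kG).
Proof.
apply: (@finite_dimensional_finType _ gT (fun g => g%:e : kG^o)) => a.
exists (fun g => a g : k); rewrite [LHS]group_algebra_sum.
apply: eq_bigr => g _.
by rewrite -[RHS]/(((a g : k)%:A : kG) * g%:e) -scalerAl mul1r.
Qed.

Lemma augmentationD (a b : kG) : augmentation (a + b) = augmentation a +
  augmentation b.
Proof. by rewrite /augmentation -big_split; apply: eq_bigr => g _;
  rewrite ffunE. Qed.

Lemma trivial_moduleZ (a : kG) (y : trivial_module k gT) :
  a *: y = augmentation a * (y : k) :> k.
Proof. by []. Qed.

Lemma augmentation_linear :
  linear (fun a : kG^o => augmentation a : trivial_module k gT).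
Proof.
move=> c x y; rewrite augmentationD; congr (_ + _).
rewrite -[RHS]/(augmentation c * augmentation x).
rewrite /augmentation mulr_suml.
under eq_bigr => z _ do rewrite ffunE.
rewrite exchange_big /=; apply: eq_bigr => z _.
by rewrite mulr_sumr (reindex_inj (mulgI z)); apply: eq_bigr => l _;
  rewrite mulKg.
Qed.

Definition augmentation_map := mk_linear augmentation_linear.

Lemma augmentation_scalar c : augmentation (c%:A : kG) = c.
Proof.
rewrite /augmentation (bigD1 1%g) //= !ffunE eqxx big1 ?addr0;
  first exact: mulr1.
by move=> g ng; rewrite !ffunE (negbTE ng) scaler0.
Qed.

Lemma augmentation_group_element g : augmentation (g%:e : kG) = 1.
Proof.
rewrite /augmentation (bigD1 g) //= ffunE eqxx big1 ?addr0 // => h nh.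
by rewrite ffunE (negbTE nh).
Qed.

Lemma augmentation_map_surjective y : exists a, augmentation_map a = y.
Proof. by exists ((y : k)%:A : kG); exact: augmentation_scalar. Qed.

Lemma finite_dimensional_trivial : finite_dimensional (trivial_module k gT).
Proof.
exact: finite_dimensional_image augmentation_map_surjective
  finite_dimensional_group_algebra.
Qed.

End FiniteDimensional.

Section Necessity.
Variables (p : nat) (k : fieldType) (gT : finGroupType) (x : gT).
Hypotheses (p_prime : prime p) (k_char : p \in [pchar k]).
Hypotheses (x_central : x \in 'C([set: gT])%g) (x_order : #[x]%g = p).
Local Notation kG := (group_algebra k gT).
Local Notation t := (aug_elt k x).

Section ImageProperty.
Variables (b : kG) (b_aug : augmentation b = 0).

(* The invariant: true for k and transported to all suspensions of k. *)
Definition kernel_to_image (X : lmodType kG) : Prop :=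
  forall m (y : X), (m <= p)%N -> t ^+ m *: y = 0 ->
  exists w, b *: y = t ^+ (p - m) *: w.

Lemma kernel_to_image_trivial : kernel_to_image (trivial_module k gT).
Proof.
move=> m y _ _; exists 0; rewrite scaler0.
by apply: etrans (trivial_moduleZ _ _) _; rewrite b_aug mul0r.
Qed.

Lemma kernel_to_image_product (I : Type) (X : I -> lmodType kG) :
  (forall i, kernel_to_image (X i)) -> kernel_to_image (product_module X).
Proof.
move=> XQ m y lemp ty.
have yQ i : exists w, b *: y i = t ^+ (p - m) *: w.
  by apply: XQ => //; exact: (congr1 (fun z : product_module X => z i) ty).
exists (fun i => sval (cid (yQ i))); apply: functional_extensionality_dep => i.
exact: (svalP (cid (yQ i))).
Qed.

Variable C : lmodType kG -> Prop.

(** Write y = r (s y) - v (u y). The first term inherits the property from Y; for the second, u y is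
    in im t^(p-m) since P is projective, and b preserves this image since t is central. *)
Lemma kernel_to_image_retract (X Y : lmodType kG) :
  stable_retract C X Y -> kernel_to_image Y -> kernel_to_image X.
Proof.
move=> [s [r [P [u [v [_ prP E]]]]]] YQ m y lemp ty.
have [|w ew] := YQ m (s y) lemp; first by rewrite -linearZ ty linear0.
have [|z ez] := projective_exact p_prime k_char x_order prP lemp (y := u y).
  by rewrite -linearZ ty linear0.
exists (r w - v (b *: z)).
have -> : y = r (s y) - v (u y) by rewrite -E /= opprB addrC subrK.
rewrite !scalerBr -linearZ ew linearZ /= ez !linearZ /=.
by rewrite !scalerA aug_elt_central.
Qed.

Lemma stable_isoC (X Y : lmodType kG) : stable_iso C X Y -> stable_iso C Y X.
Proof. by move=> [f [g [? ?]]]; exists g, f. Qed.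

Lemma stable_iso_retract (X Y : lmodType kG) : stable_iso C X Y ->
  stable_retract C X Y.
Proof. by move=> [f [g [? ?]]]; exists f, g. Qed.

(* Dimension shifting, exchanging m and p - m. *)
Lemma kernel_to_image_syzygy (K Y : lmodType kG) :
  is_syzygy C K Y -> kernel_to_image K <-> kernel_to_image Y.
Proof.
move=> [P [q [j [_ prP qs j_inj qjP]]]].
have qj y : q (j y) = 0 by apply/qjP; exists y.
have exP := projective_exact p_prime k_char x_order prP.
split=> Q m y lemp ty.
  (* From K to Y: lift y to z. Then t^m z lies in K and is killed by t^(p-m), so b t^m z = t^m w
     with w in K, and b z - w is in ker t^m = im t^(p-m). *)
  have [z ez] := qs y; rewrite -{y}ez in ty *.
  have [|y' ey'] := (qjP (t ^+ m *: z)).1; first by rewrite linearZ.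
  have [|w ew] := Q (p - m)%N y' (leq_subr _ _).
    by apply: j_inj; rewrite linearZ /= ey' scalerA -exprD subnK // (aug_eltXp
      k_char) // scale0r linear0.
  have [|w' ew'] := exP m (b *: z - j w) lemp.
    rewrite scalerBr -[X in _ - X]linearZ scalerA -aug_elt_central // -scalerA
      -ey'.
    by rewrite -linearZ ew subKn // subrr.
  exists (q w'); rewrite -!linearZ -ew' linearB /= qj subr0.
  by rewrite linearZ.
(* From Y to K: write y = t^(p-m) z. Then b q(z) = t^m w; with w0 over w, the element b z - t^m w0
   lies in K, and t^(p-m) maps it to b y because t^p = 0. *)
have [|z ez] := exP m (j y) lemp; first by rewrite -linearZ ty linear0.
have [|w ew] := Q (p - m)%N (q z) (leq_subr _ _);
  first by rewrite -linearZ -ez qj.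
rewrite subKn // in ew.
have [w0 ew0] := qs w.
have [|y' ey'] := (qjP (b *: z - t ^+ m *: w0)).1.
  rewrite linearB !linearZ /= ew ew0. by rewrite scalerN subrr.
exists y'; apply: j_inj; rewrite !linearZ /= ey' ez scalerBr !scalerA.
by rewrite -exprD subnK // (aug_eltXp k_char) // scale0r subr0 aug_elt_central.
Qed.

Lemma kernel_to_image_Omega_iter n (M X : lmodType kG) :
  is_Omega_iter C n M X -> kernel_to_image M <-> kernel_to_image X.
Proof.
elim: n X => [|n IHn] X /=.
  move=> XM; split; apply: kernel_to_image_retract;
    apply: stable_iso_retract => //.
  exact: stable_isoC.
move=> [Y [K [_ _ /IHn -> /kernel_to_image_syzygy <- XK]]].
split; apply: kernel_to_image_retract; apply: stable_iso_retract => //.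
exact: stable_isoC.
Qed.

(** For i < 0 it is k that is an iterated syzygy of X, so the equivalence along syzygies is needed
    in both directions. *)
Lemma kernel_to_image_suspension (i : int) (X : lmodType kG) :
  is_Omega_k C i X -> kernel_to_image X.
Proof.
case: i => n [_ /kernel_to_image_Omega_iter]; have := kernel_to_image_trivial;
  tauto.
Qed.

End ImageProperty.

(* D_m = ker t^m in kG, which is isomorphic to kG / t^m kG. *)
Definition truncated (m : nat) : lmodType kG :=
  kernel_module (@central_scale _ kG^o _ (aug_elt_central x_central m)).

Definition truncated_inj {m} : {linear truncated m -> kG^o} := kernel_inj _.

Lemma truncated_inj0 m (y : truncated m) : t ^+ m * truncated_inj y = 0 :> kG.
Proof. exact: (kernel_injP (f := @central_scale _ kG^o _ (aug_elt_central
  x_central m))). Qed.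

Lemma truncated_injective m : injective (@truncated_inj m).
Proof. exact: kernel_inj_injective. Qed.

Lemma truncated_scale m (y : truncated m) : t ^+ m *: y = 0.
Proof. by apply: truncated_injective; rewrite linearZ linear0;
  exact: truncated_inj0. Qed.

Section Lift.
Variables (m : nat) (M : lmodType kG) (h : {linear M -> kG^o}).
Hypothesis th : forall y, t ^+ m * (h y : kG) = 0.

Definition truncated_lift : {linear M -> truncated m} :=
  @kernel_lift _ _ _ (@central_scale _ kG^o _ (aug_elt_central x_central m)) _
    h th.

Lemma truncated_liftK y : truncated_inj (truncated_lift y) = h y.
Proof. by []. Qed.

End Lift.

Section Generator.
Variables (m : nat).
Hypothesis (m_le : (m <= p)%N).

Lemma generator_linear : linear (fun a : kG^o => t ^+ (p - m) * (a : kG) :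
  kG^o).
Proof.
by move=> c y z; rewrite mulrDr; congr (_ + _);
  rewrite mulrA -aug_elt_central // -mulrA.
Qed.

Lemma generator_kernel y : t ^+ m * (mk_linear generator_linear y : kG) = 0.
Proof. by rewrite mulrA -exprD subnKC // (aug_eltXp k_char) // mul0r. Qed.

(** Presents D_m as a cyclic module: the image of 1 is the generator t^(p-m). *)
Definition truncated_cover : {linear kG^o -> truncated m} :=
  truncated_lift generator_kernel.

Lemma truncated_coverE a : truncated_inj (truncated_cover a) = t ^+ (p - m) *
  (a : kG).
Proof. by []. Qed.

Lemma truncated_cover_surjective y : exists a, truncated_cover a = y.
Proof.
have [w ew] := group_algebra_exact p_prime k_char x_order m_le (truncated_inj0
  y).
by exists w; apply: truncated_injective; rewrite ew.
Qed.

Lemma finite_dimensional_truncated : finite_dimensional (truncated m).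
Proof.
exact: finite_dimensional_image truncated_cover_surjective
  (finite_dimensional_group_algebra _ _).
Qed.

End Generator.

(** * The obstruction on D_m and the resulting dual ghost *)

Section Obstruction.
Variables (m : nat) (b : kG).
Hypotheses (m_le : (m <= p - m)%N) (b_aug : augmentation b = 0).
Hypothesis b_nin : forall c, b <> t ^+ m * c.

Let m_lep : (m <= p)%N. Proof. exact: leq_trans m_le (leq_subr _ _). Qed.

(** By exactness of kG, the vanishing of this product would put b into t^m kG. *)
Let top_nonzero : t ^+ (p - m) * b <> 0.
Proof.
move=> /(group_algebra_exact p_prime k_char x_order (leq_subr m p)) [c].
by rewrite subKn //; exact: b_nin.
Qed.

Let kill (y : truncated m) : t ^+ (p - m) *: y = 0.
Proof. by rewrite -(subnK m_le) exprD -scalerA truncated_scale scaler0. Qed.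

(** The generator is killed by t^m, so b would carry it into t^(p-m) D_m = 0, whereas b t^(p-m) is
    nonzero. *)
Lemma truncated_not_kernel_to_image : ~ kernel_to_image b (truncated m).
Proof.
move=> /(_ m (truncated_cover m_lep 1) m_lep (truncated_scale _)) [w].
rewrite kill => /(congr1 (@truncated_inj m)); rewrite linearZ linear0 => E.
by apply: top_nonzero; rewrite -(aug_elt_central x_central) -[t ^+ _]mulr1;
  exact: E.
Qed.

Variable C : lmodType kG -> Prop.

Lemma truncated_not_retract (I : Type) (X : I -> lmodType kG) :
  (forall i, is_suspension_of_k C (X i)) ->
  ~ stable_retract C (truncated m) (product_module X).
Proof.
move=> XS /kernel_to_image_retract R; apply: truncated_not_kernel_to_image.
apply: R; apply: kernel_to_image_product => i; have [j Xj] := XS i.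
exact: (kernel_to_image_suspension b_aug Xj).
Qed.

Let right_mul_linear : linear (fun y : truncated m => (truncated_inj y : kG) *
  b : kG^o).
Proof. by move=> c y z; rewrite linearP mulrDl; congr (_ + _);
  rewrite -mulrA. Qed.

Let right_mul_kernel y : t ^+ m * (mk_linear right_mul_linear y : kG) = 0.
Proof. by rewrite mulrA truncated_inj0 mul0r. Qed.

Let ghost := truncated_lift right_mul_kernel.

Lemma exists_nontrivial_dual_ghost :
  C kG^o -> C (truncated m) -> ~ no_nontrivial_dual_ghosts C.
Proof.
move=> CkG CD noghost.
have [i X Xi f|P [u [v [_ prP E]]]] := noghost _ _ CD CD ghost.
  have [|w ew] := kernel_to_image_suspension b_aug Xi
      (y := f (truncated_cover m_lep 1)) m_lep; last 1 first.
    (* Since b f(gen) = t^(p-m) w, the composite of f with the ghost sends a gen to a t^(p-m) w. It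
       is therefore the inclusion of D_m into kG followed by a |-> a w. *)
    have w_lin : linear (fun a : kG^o => a *: w).
      by move=> c y z; rewrite scalerDl scalerA.
    exists kG^o, truncated_inj, (mk_linear w_lin); split=> // [|y].
      exact: group_algebra_projective.
    have [a <-] := truncated_cover_surjective m_lep y.
    have -> : truncated_cover m_lep a = a *: truncated_cover m_lep 1.
      by rewrite -linearZ; congr (truncated_cover _ _);
        rewrite /GRing.scale /= mulr1.
    rewrite [LHS]linearZ [truncated_inj _]linearZ [RHS]linearZ; congr (_ *: _).
    rewrite -[LHS]/(f (ghost (truncated_cover m_lep 1))).
    have -> : ghost (truncated_cover m_lep 1) = b *: truncated_cover m_lep 1.
      apply: truncated_injective; rewrite linearZ truncated_liftK
        truncated_coverE.
      rewrite -[LHS]/(t ^+ (p - m) * 1 * b) -[RHS]/(b * (t ^+ (p - m) * 1))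
        !mulr1.
      by rewrite (aug_elt_central x_central).
    by rewrite [LHS]linearZ [LHS]ew -[RHS]/((t ^+ (p - m) * 1) *: w) mulr1.
  by rewrite -linearZ truncated_scale linear0.
(* If the ghost factored through a projective, the image of the generator there would be in im
   t^(p-m), so its image in D_m would be 0. *)
apply: top_nonzero.
have [|w ew] := projective_exact p_prime k_char x_order prP m_lep
    (y := u (truncated_cover m_lep 1)).
  by rewrite -linearZ truncated_scale linear0.
have : ghost (truncated_cover m_lep 1) = 0 by rewrite E ew [v _]linearZ
  [LHS]kill.
move=> /(congr1 truncated_inj); rewrite truncated_liftK linear0 => <-.
by rewrite -[RHS]/(t ^+ (p - m) * 1 * b) mulr1.
Qed.

End Obstruction.
End Necessity.

Arguments truncated_inj {k gT x x_central m}.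

(** * Linear maps over k[t]/t^p *)

Section ShiftSum.
Variables (p : nat) (k : fieldType) (gT : finGroupType) (x : gT).
Hypotheses (p_prime : prime p) (k_char : p \in [pchar k]).
Hypotheses (x_central : x \in 'C([set: gT])%g) (x_order : #[x]%g = p).
Hypothesis x_gen : forall g, g \in <[x]>%g.
Local Notation kG := (group_algebra k gT).
Local Notation t := (aug_elt k x).
Local Notation triv := (trivial_module k gT).

Lemma linear_commuting (M N : lmodType kG) (f : kspace M -> kspace N) :
  linear f -> (forall y : M, f (t *: y) = t *: (f y : N)) ->
    linear (f : M -> N).
Proof.
move=> fl ft; apply: linear_group_elements => // g y.
have fx z : f (x%:e *: z) = x%:e *: (f z : N).
  have xE (L : lmodType kG) (z' : L) : x%:e *: z' = t *: z' + z'.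
    by rewrite scalerBl scale1r subrK.
  by rewrite !xE -ft; exact: (linearD (mk_linear fl)).
have /cycleP [i ->] := x_gen g.
elim: i => [|i IHi]; first by rewrite expg0 group_element1 !scale1r.
by rewrite expgS group_elementM -!scalerA fx IHi.
Qed.

Lemma aug_elt_scale_ge (M : lmodType kG) n m (y : M) : (n <= m)%N ->
  t ^+ n *: y = 0 -> t ^+ m *: y = 0.
Proof. by move=> le_nm ty; rewrite -(subnK le_nm) exprD -scalerA ty scaler0.
  Qed.

Section Def.
Variables (n : nat) (M N : lmodType kG) (l : {linear kspace M -> kspace N}).

(* The trace form of k[t]/t^(n+1): for l merely k-linear this sum commutes with
   t as soon as t^(n+1) vanishes on both sides. *)
Definition shift_sum (y : M) : N := \sum_(j < n.+1) t ^+ (n - j) *: (l (t ^+ j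
  *: y) : N).

Lemma shift_sum_klinear : linear (shift_sum : kspace M -> kspace N).
Proof.
move=> c y z; rewrite kspaceZ [X in _ = X + _]kspaceZ /shift_sum scaler_sumr
  -big_split.
apply: eq_bigr => j _ /=.
rewrite scalerDr scalerA algebra_scalar_comm -scalerA klinD klinZ scalerDr.
by rewrite !scalerA algebra_scalar_comm.
Qed.

(** Applying t on either side shifts the summation index by one; the two boundary terms contain
    t^(n+1) and vanish. *)
Lemma shift_sum_linear : (forall y : M, t ^+ n.+1 *: y = 0) ->
  (forall y : N, t ^+ n.+1 *: y = 0) -> linear shift_sum.
Proof.
move=> Mn Nn; apply: linear_commuting => [|y]; first exact: shift_sum_klinear.
rewrite /shift_sum big_ord_recr /= subnn scale1r scalerA -exprSr Mn klin0 addr0.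
rewrite scaler_sumr [RHS]big_ord_recl /= subn0 scalerA -exprS Nn add0r.
apply: eq_bigr => j _.
by rewrite !scalerA -exprSr -exprS /bump add1n -subSn.
Qed.

Lemma shift_sum_top y : (forall z : N, t ^+ n.+1 *: z = 0) ->
  t ^+ n *: shift_sum y = t ^+ n *: (l (t ^+ n *: y) : N).
Proof.
move=> Nn; rewrite /shift_sum big_ord_recr /= subnn scale1r scalerDr
  scaler_sumr.
rewrite big1 ?add0r // => j _; rewrite scalerA -exprD.
by apply: aug_elt_scale_ge (Nn _); rewrite -addn1 leq_add2l subn_gt0.
Qed.

Lemma shift_sum_bottom y : t *: y = 0 -> shift_sum y = t ^+ n *: (l y : N).
Proof.
move=> ty; rewrite /shift_sum big_ord_recl /= subn0 scale1r big1 ?addr0 // => j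
  _.
by rewrite /bump add1n exprSr -scalerA ty scaler0 klin0 scaler0.
Qed.

End Def.

Lemma aug_elt_scale_p (M : lmodType kG) (y : M) : t ^+ p.-1.+1 *: y = 0.
Proof. by rewrite prednK ?prime_gt0 // (aug_eltXp k_char) // scale0r. Qed.

(* Lift l to the free cover of N before taking the shift sum. *)
Lemma shift_sum_stably_trivial (C : lmodType kG -> Prop) (M N : lmodType kG)
    (l : {linear kspace M -> kspace N}) :
  C (free_module N) -> stably_trivial C (shift_sum p.-1 l).
Proof.
move=> CF; pose d := mk_linear (@free_delta_linear _ _ N).
have u_lin := @shift_sum_linear p.-1 M _ (d \o l)
  (@aug_elt_scale_p _) (@aug_elt_scale_p _).
exists (free_module N), (mk_linear u_lin), (free_cover N).
split=> // [|y]; first exact: free_module_projective.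
transitivity (free_cover N (shift_sum p.-1 (d \o l) y)) => //.
rewrite /shift_sum linear_sum; apply: eq_bigr => j _.
by rewrite linearZ; congr (_ *: _); rewrite [RHS]free_lift_delta.
Qed.

(* The coefficient of t^(p-1) in the basis of the t^j of kG. *)
Definition top_coef (a : kspace kG^o) : kspace triv := (a : kG) (x ^+ p.-1)%g.

Lemma top_coef_linear : linear top_coef.
Proof.
move=> c a b; rewrite /top_coef !kspaceZ.
have aE : (c%:A : kG) *: (a : kG^o) = c *: (a : kG) by rewrite -[LHS]scalerAl
  mul1r.
rewrite aE !ffunE; congr (_ + _).
by apply/esym; apply: etrans (trivial_moduleZ _ _) _;
  rewrite augmentation_scalar.
Qed.

Definition top_functional := mk_linear top_coef_linear.

(** Multiplication by x - 1 subtracts the coefficient at i from the one at i - 1, so the range j <=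
    i is stable under the induction and no binomial coefficients appear. *)
Lemma aug_eltX_coef j i : (j <= i < p)%N -> (t ^+ j) (x ^+ i)%g = (i == j)%:R.
Proof.
elim: j i => [|j IHj] i /andP [ji ip].
  rewrite ffunE -[1%g](expg0 x) eq_expg_mod_order x_order !modn_small //.
  exact: prime_gt0.
have i0 : (0 < i)%N by apply: leq_trans ji.
have shift (a : kG) y : (a * x%:e) y = a (y * x^-1)%g.
  rewrite ffunE (bigD1 (y * x^-1)%g) //= ffunE invMg invgK mulgKV eqxx mulr1.
  rewrite big1 ?addr0 // => z nz; rewrite ffunE.
  suff /negbTE -> : (z^-1 * y)%g != x by rewrite mulr0.
  by apply: contraNneq nz => <-; rewrite invMg invgK mulKVg.
rewrite exprSr mulrBr mulr1 ffunE shift ffunE -{1}(prednK i0) expgSr mulgK.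
rewrite !IHj; try (clear -ji ip i0; lia).
by rewrite (gtn_eqF ji) subr0 -[in RHS](prednK i0) eqSS.
Qed.

Definition scalar_elt (c : kspace triv) : kspace kG^o := ((c : k)%:A : kG).

Lemma scalar_elt_linear : linear scalar_elt.
Proof.
move=> c a b; rewrite /scalar_elt !kspaceZ.
have -> : (c%:A : kG) *: (a : triv) = c * (a : k) :> k.
  by apply: etrans (trivial_moduleZ _ _) _; rewrite augmentation_scalar.
rewrite scalerDl; congr (_ + _).
by rewrite -[RHS]scalerAl mul1r scalerA.
Qed.

Definition scalar := mk_linear scalar_elt_linear.

Lemma top_aug_eltX (j : nat) (c : triv) : (j <= p.-1)%N ->
  top_functional (t ^+ j *: (scalar c : kG^o) : kG^o) = if j == p.-1 then c
    else 0.
Proof.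
move=> jp; rewrite -[LHS]/((t ^+ j * (c : k)%:A : kG) _).
rewrite -scalerAr mulr1 ffunE aug_eltX_coef.
  by rewrite eq_sym; case: ifP => _; [exact: mulr1 | exact: mulr0].
by rewrite jp /= prednK ?prime_gt0.
Qed.

Section Dual.
Variables (M : lmodType kG) (phi : {linear kspace M -> kspace triv}).

(* The bijection between k-linear forms on M and homomorphisms M -> kG. *)
Definition dual_map : {linear M -> kG^o} :=
  mk_linear (@shift_sum_linear p.-1 M kG^o (scalar \o phi)
    (@aug_elt_scale_p _) (@aug_elt_scale_p _)).

Lemma top_dual_map y : top_functional (dual_map y) = phi y.
Proof.
rewrite -[dual_map y]/(shift_sum _ _ _) /shift_sum klin_sum.
have E (j : 'I_p.-1.+1) : top_functional (t ^+ (p.-1 - j) *: (scalar \o phi) (t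
  ^+ j *: y) : kG^o) =
    if (p.-1 - j)%N == p.-1 then phi (t ^+ j *: y) else 0.
  exact: top_aug_eltX (leq_subr _ _).
rewrite (bigD1 ord0) // E subn0 eqxx scale1r big1 => [|j nj].
  exact: addr0.
rewrite E; case: eqP => // jp; case/eqP: nj; apply: val_inj => /=.
by move: (ltn_ord j) jp; clear; lia.
Qed.

End Dual.

(** Both sides are kG-linear in a, so a = 1 suffices; there only the term j = p - 1 survives. *)
Lemma top_expansion (a : kG^o) : a = dual_map top_functional a.
Proof.
have E1 : dual_map top_functional 1 = 1.
  have top1 (j : 'I_p.-1.+1) : scalar (top_functional (t ^+ j *: (1 : kG^o) :
    kG^o)) =
      if (j : nat) == p.-1 then 1 else 0.
    have := top_aug_eltX (1 : k) (ltn_ord j).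
    rewrite [scalar _]scale1r => ->; case: ifP => _; last exact: linear0.
    exact: (scale1r (1 : kG)).
  rewrite -[LHS]/(\sum_(j < _) t ^+ _ *: scalar (top_functional (t ^+ j *: (1 :
    kG^o) : kG^o))).
  rewrite (bigD1 ord_max) // top1 eqxx subnn scale1r big1 => [|j nj];
    first exact: addr0.
  rewrite top1; case: eqP => [jp|_]; last exact: scaler0.
  by case/eqP: nj; apply: val_inj.
have aE : a = a *: (1 : kG^o) by rewrite -[RHS]/((a : kG) * 1) mulr1.
by rewrite [in RHS]aE linearZ E1.
Qed.

(** On the socle ker t the expansion reduces to t^(p-1) times the top coefficient. *)
Lemma top_eq0 (a : kG^o) : t *: a = 0 -> top_functional a = 0 -> a = 0.
Proof.
move=> ta a0; rewrite (top_expansion a) -[LHS]/(shift_sum _ _ _).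
rewrite shift_sum_bottom // -[X in _ *: X]/(scalar (top_functional a)) a0.
by rewrite [scalar _]linear0 scaler0.
Qed.

End ShiftSum.

(** * Coordinates *)

Section Coordinates.
Variables (k : fieldType) (gT : finGroupType).
Local Notation kG := (group_algebra k gT).
Local Notation triv := (trivial_module k gT).

Definition coordinate_space (I : Type) : lmodType kG :=
  product_module (fun _ : I => triv : lmodType kG).

Lemma trivial_kspaceZ (c : k) (y : kspace triv) : c *: y = c * (y : k) :> k.
Proof. by apply: etrans (trivial_moduleZ _ _) _;
  rewrite augmentation_scalar. Qed.

Lemma coordinate_spaceZ I (c : k) (y : kspace (coordinate_space I)) i :
  (c *: y) i = c * (y i : k) :> k.
Proof. exact: trivial_kspaceZ. Qed.

(** A generalized inverse g of c |-> c y is itself a functional, and it satisfies g(y) y = y. *)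
Lemma functionals_separate (M : lmodType kG) (y : M) :
  (forall phi : {linear kspace M -> kspace triv}, phi y = 0) -> y = 0.
Proof.
move=> y0.
have f_lin : linear (fun c : kspace triv => (c : k) *: (y : kspace M)).
  move=> c a b; rewrite scalerDl scalerA; congr (_ *: _ + _).
  exact: trivial_kspaceZ.
have [g gE] := generalized_inverse (mk_linear f_lin).
have := gE 1; rewrite /= scale1r y0 => <-.
exact: (scale0r (y : kspace M)).
Qed.

(** In place of a basis: evaluation at all functionals embeds M into a power of k, and its
    generalized inverse is a retraction. *)
Lemma exists_coordinates (M : lmodType kG) :
  exists (I : Type) (a : {linear kspace M -> kspace (coordinate_space I)})
    (b : {linear kspace (coordinate_space I) ->
      kspace M}), forall y, b (a y) = y.
Proof.
exists {linear kspace M -> kspace triv}.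
pose ev (y : kspace M) : kspace (coordinate_space {linear kspace M ->
  kspace triv}) :=
  fun phi => phi y.
have ev_lin : linear ev.
  move=> c y z; apply: functional_extensionality_dep => phi.
  by rewrite /ev (linearP phi).
have [b bE] := generalized_inverse (mk_linear ev_lin).
exists (mk_linear ev_lin), b => y; apply/eqP; rewrite -subr_eq0; apply/eqP.
apply: functionals_separate => phi; rewrite [LHS]linearB.
have := congr1 (fun z : coordinate_space _ => z phi) (bE y).
by rewrite /= /ev => ->; exact: subrr.
Qed.

Lemma idempotent_mx_split n (m : 'M[k]_n) : m *m m = m ->
  exists r (C : 'M_(n, r)) (R : 'M_(r, n)), C *m R = m /\ R *m C = 1%:M.
Proof.
move=> m_idem; exists (\rank m), (col_base m), (row_base m).
have [B BC] := row_fullP (col_base_full m).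
have [B' RB] := row_freeP (row_base_free m).
move: (mulmx_base m) BC RB; move: (col_base m) (row_base m) => C R CR BC RB.
(* With B C = 1 and R B' = 1, the product R C equals B (C R)(C R) B' = B (C R) B' = 1. *)
split=> //; transitivity (B *m (C *m R *m (C *m R)) *m B').
  by rewrite !mulmxA BC mul1mx -mulmxA RB mulmx1.
by rewrite CR m_idem -[X in B *m X]CR mulmxA BC mul1mx RB.
Qed.

(* Rank factorisation of f, obtained by splitting an idempotent matrix. *)
Lemma finite_coordinates (M : lmodType kG) (f : {linear kspace M -> kspace M}) :
  finite_dimensional M ->
  exists (r : nat) (a : {linear kspace M -> kspace (coordinate_space 'I_r)})
    (b : {linear kspace (coordinate_space 'I_r) -> kspace M}),
    (forall c, a (f (b c)) = c) /\ (forall y, f (b (a (f y))) = f y).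
Proof.
move=> [n [e eM]].
pose sum_e (c : 'rV[k]_n) : kspace M := \sum_i c 0 i *: (e i : kspace M).
have sum_e_lin : linear sum_e.
  move=> c u v; rewrite /sum_e scaler_sumr -big_split; apply: eq_bigr => i _.
  by rewrite !mxE scalerDl scalerA.
pose b0 := mk_linear sum_e_lin.
have b0s y : exists c, b0 c = y.
  have [c ->] := eM y; exists (\row_i c i).
  by apply: eq_bigr => i _; rewrite mxE.
have [a0 a0E] := generalized_inverse b0.
have a0K y : b0 (a0 y) = y by have [c <-] := b0s y; exact: a0E.
have [l lE] := generalized_inverse f.
(* The matrix of the idempotent l f in the coordinates of the spanning family; it is idempotent
   because b0 a0 = 1 and f l f = f. *)
pose m := lin1_mx (a0 \o l \o f \o b0).
have mE u : u *m m = a0 (l (f (b0 u))) by rewrite mul_rV_lin1.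
have m_idem : m *m m = m.
  by apply/row_matrixP => i; rewrite !rowE mulmxA !mE a0K lE.
have [r [Cm [Rm [CR RC]]]] := idempotent_mx_split m_idem.
pose to_row (c : kspace (coordinate_space 'I_(r))) : 'rV[k]_(r) :=
  \row_i (c i : k).
pose of_row (u : 'rV[k]_(r)) : kspace (coordinate_space 'I_(r)) :=
  fun i => u 0 i.
have to_rowK c : of_row (to_row c) = c.
  by apply: functional_extensionality_dep => i; rewrite /of_row mxE.
have of_rowK u : to_row (of_row u) = u.
  by apply/rowP => i; rewrite mxE.
have to_row_lin : linear to_row.
  move=> c u v; apply/rowP => i; rewrite !mxE.
  by congr (_ + _); exact: coordinate_spaceZ.
have of_row_lin : linear of_row.
  move=> c u v; rewrite -[RHS]to_rowK; congr of_row.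
  by rewrite to_row_lin !of_rowK.
have b_lin : linear (fun c => b0 (to_row c *m Rm)).
  by move=> c u v; rewrite to_row_lin mulmxDl -scalemxAl linearP.
have a_lin : linear (fun y => of_row (a0 (l y) *m Cm)).
  by move=> c u v; rewrite !linearP mulmxDl -scalemxAl of_row_lin.
exists (r), (mk_linear a_lin), (mk_linear b_lin); split=> [c|y] /=.
  rewrite -mE -CR -!mulmxA RC mulmx1 RC mulmx1.
  exact: to_rowK.
rewrite of_rowK -mulmxA CR mE.
by rewrite !a0K lE -[sum_e _]/(b0 _) a0K lE.
Qed.

End Coordinates.

(** * Splitting off copies of k[t]/t^(n+1) *)

Section Decomposition.
Variables (p : nat) (k : fieldType) (gT : finGroupType) (x : gT).
Hypotheses (p_prime : prime p) (k_char : p \in [pchar k]).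
Hypotheses (x_central : x \in 'C([set: gT])%g) (x_order : #[x]%g = p).
Hypothesis x_gen : forall g, g \in <[x]>%g.
Local Notation kG := (group_algebra k gT).
Local Notation t := (aug_elt k x).
Local Notation triv := (trivial_module k gT).
Local Notation truncated := (truncated k x_central).
Local Notation dual_map := (dual_map p_prime k_char x_order x_gen).
Local Notation top := (@top_functional p k gT x).

Section TruncatedPower.
Variables (n : nat) (I : Type).

Definition truncated_power : lmodType kG := product_module (fun _ : I =>
  truncated n.+1).
Local Notation P := truncated_power.

Lemma truncated_power_scale (z : P) : t ^+ n.+1 *: z = 0.
Proof. by apply: functional_extensionality_dep => i;
  exact: truncated_scale. Qed.

Definition coef_map (z : kspace P) : kspace (coordinate_space k gT I) :=
  fun i => top (truncated_inj (z i)).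

Lemma coef_map_linear : linear coef_map.
Proof.
move=> c y z; apply: functional_extensionality_dep => i.
by rewrite /coef_map [truncated_inj _]linearP [LHS]klinD [X in X + _]klinZ.
Qed.

Definition coef := mk_linear coef_map_linear.

Lemma coef_eq0 (z : P) : t *: z = 0 -> coef z = 0 -> z = 0.
Proof.
move=> tz cz; apply: functional_extensionality_dep => i.
apply: truncated_injective; rewrite linear0.
apply: (top_eq0 p_prime k_char x_order x_gen); last first.
  exact: (congr1 (fun y : coordinate_space k gT I => y i) cz).
rewrite -linearZ -[X in truncated_inj X]/((t *: z) i) tz.
exact: linear0.
Qed.

Section Maps.
Variables (M : lmodType kG) (M_scale : forall y : M, t ^+ n.+1 *: y = 0).
Variables (al : {linear kspace M -> kspace (coordinate_space k gT I)}).
Variables (be : {linear kspace (coordinate_space k gT I) -> kspace M}).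

Lemma functional_linear i : linear (fun y : kspace M => (al y i : kspace triv)).
Proof. by move=> c y z; rewrite linearP. Qed.

Definition functional i := mk_linear (functional_linear i).

Lemma dual_map_scale i y : t ^+ n.+1 * (dual_map (functional i) y : kG) = 0.
Proof. by rewrite -[LHS]linearZ M_scale linear0. Qed.

(** Coordinate i is the kG-map M -> kG whose top coefficient is [al y i]; it lands in D_(n+1)
    because t^(n+1) kills M. *)
Definition to_power_fun (y : M) : P := fun i => truncated_lift x_central
  (dual_map_scale i) y.

Lemma to_power_linear : linear to_power_fun.
Proof. by move=> c y z; apply: functional_extensionality_dep => i;
  exact: linearP. Qed.

Definition to_power := mk_linear to_power_linear.

Lemma coef_to_power y : coef (to_power y) = al y.
Proof. by apply: functional_extensionality_dep => i; exact: top_dual_map. Qed.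

Definition of_power : {linear P -> M} :=
  mk_linear (shift_sum_linear x_gen (be \o coef) truncated_power_scale M_scale).

Lemma of_powerK y : of_power (to_power y) = shift_sum x n (be \o al) y.
Proof.
apply: eq_bigr => j _; congr (_ *: _).
by rewrite -linearZ -[LHS]/(be (coef (to_power (t ^+ j *: y)))) coef_to_power.
Qed.

Lemma of_to_power_top y :
  (forall y, t ^+ n *: (be (al (t ^+ n *: y)) : M) = t ^+ n *: y) ->
  t ^+ n *: (of_power (to_power y)) = t ^+ n *: y.
Proof. by move=> E; rewrite of_powerK shift_sum_top //; exact: E. Qed.

Section Split.
Hypothesis (split_al : forall c, al (t ^+ n *: (be c : M)) = c).

Let nu_fun (z : P) : P := z - to_power (of_power z).

Let nu_linear : linear nu_fun.
Proof. by move=> c y z; rewrite /nu_fun [of_power _]linearP [to_power _]linearP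
  scalerBr opprD addrACA. Qed.

Let nu := mk_linear nu_linear.

(** An element of the socle is determined by its top coefficients, and [split_al] says that the
    composite preserves them. Hence each application of [nu] lowers the power of t that kills an
    element. *)
Let nu_socle z : t *: z = 0 -> nu z = 0.
Proof.
move=> tz; apply: coef_eq0; first by rewrite -linearZ tz linear0.
rewrite -[nu z]/(z - to_power (of_power z)) klinB coef_to_power.
rewrite -[of_power z]/(shift_sum x n _ z) shift_sum_bottom //.
by rewrite split_al; exact: subrr.
Qed.

Let nu_shift m z : t ^+ m.+1 *: z = 0 -> t ^+ m *: nu z = 0.
Proof. by move=> tz; rewrite -linearZ nu_socle // scalerA -exprS. Qed.

Let nu_iter_eq0 m z : t ^+ m *: z = 0 -> iter m nu z = 0.
Proof.
elim: m z => [|m IHm] z tz; first by rewrite -[LHS]scale1r.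
by rewrite iterSr IHm //; exact: nu_shift.
Qed.

(* The inverse of AB = 1 - nu is the geometric sum of the nilpotent nu. *)
Let to_power'_fun (y : M) : P := \sum_(i < n.+1) iter i nu (to_power y).

Let to_power'_linear : linear to_power'_fun.
Proof.
move=> c y z; rewrite /to_power'_fun scaler_sumr -big_split;
  apply: eq_bigr => i _.
have iterP u v : iter i nu (c *: u + v) = c *: iter i nu u + iter i nu v.
  by elim: (i : nat) => //= j ->; exact: (linearP nu).
by rewrite [to_power _]linearP iterP.
Qed.

(** The correction keeps [to_power] unchanged on ker t, where [nu] vanishes; this makes A computable
    on multiples of t^n. *)
Lemma split_power : exists A : {linear M -> P},
  (forall z, A (of_power z) = z) /\
  (forall y, t *: y = 0 -> A y = to_power y).
Proof.
exists (mk_linear to_power'_linear); split=> [z|y ty] /=;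
  rewrite /to_power'_fun.
  have -> : to_power (of_power z) = z - nu z by rewrite /= opprB addrC subrK.
  have iterB i : iter i nu (z - nu z) = iter i nu z - iter i.+1 nu z.
    by elim: i => // i IHi; rewrite iterS IHi [LHS](linearB nu).
  under eq_bigr => i _ do rewrite iterB.
  rewrite -(big_mkord xpredT (fun i => iter i nu z - iter i.+1 nu z)).
  rewrite (telescope_sumr_eq (fun i => - iter i nu z)) // => [|i _]; last first.
    by rewrite opprK addrC.
  by rewrite nu_iter_eq0 ?oppr0 ?add0r ?opprK //; exact: truncated_power_scale.
rewrite big_ord_recl big1 ?addr0 //= => i _.
rewrite -[LHS]/(iter i.+1 nu _) iterSr nu_socle; last first.
  by rewrite -[LHS](linearZ_LR to_power) /= ty; exact: (linear0 to_power).
by elim: (i : nat) => // j IHj; rewrite iterS IHj [LHS](linear0 nu).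
Qed.

End Split.
End Maps.
End TruncatedPower.

(* [fin] selects the finite-dimensional version, in which B (A y) + b (a y) = y
   is a direct sum decomposition M = D_(n+1)^r (+) K. *)
Variant splitting (fin : Prop) n (M : lmodType kG) : Prop :=
  Splitting (I : Type) (K : lmodType kG)
    (A : {linear M -> truncated_power n I}) (B : {linear truncated_power n I ->
      M})
    (a : {linear M -> K}) (b : {linear K -> M})
    (l : {linear kspace (truncated_power n I) -> kspace M}) of
    (forall z : K, t ^+ n *: z = 0) &
    (forall z, B z = shift_sum x n l z) &
    (forall y, B (A y) + b (a y) = y) &
    (fin -> [/\ exists r (e : 'I_r -> I), bijective e, finite_dimensional K,
       forall z, A (B z) = z, forall z, a (B z) = 0 &
       (forall z, A (b z) = 0) /\ (forall z, a (b z) = z)]).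

Lemma scale_central_linear (M : lmodType kG) n : linear (fun y : M => t ^+ n *:
  y).
Proof. exact: (central_scale_linear (aug_elt_central x_central n)). Qed.

(** In both cases A and B are built so that t^n B A = t^n, which makes 1 - B A take values in ker
    t^n. *)
Lemma exists_splitting (fin : Prop) n (M : lmodType kG) : 
  (fin -> finite_dimensional M) -> (forall y : M, t ^+ n.+1 *: y = 0) ->
  splitting fin n M.
Proof.
move=> finM Mn; pose f := kscale M (t ^+ n).
have [isfin|nfin] := pselect fin; last first.
  (* Without finiteness, all of M is given coordinates and l chooses preimages under t^n; K is ker
     t^n. *)
  have [I [al [be beK]]] := exists_coordinates M.
  have [l lE] := generalized_inverse f.
  pose A := to_power Mn al; pose B := of_power Mn (l \o be).
  have BA y : t ^+ n *: B (A y) = t ^+ n *: y.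
    by apply: of_to_power_top => z; rewrite /= beK; exact: lE.
  pose q := mk_linear (@scale_central_linear M n).
  have d_lin : linear (fun y => y - B (A y)).
    by move=> c y z; rewrite [A _]linearP [B _]linearP scalerBr opprD addrACA.
  have d_ker y : q (mk_linear d_lin y) = 0 by rewrite /= scalerBr BA subrr.
  exists I (kernel_module q) A B (kernel_lift d_ker) (kernel_inj q) ((l \o be)
    \o @coef n _) => //.
  - by move=> z; apply: kernel_inj_injective; rewrite linearZ linear0;
    exact: kernel_injP.
  - by move=> y; rewrite kernel_liftK addrC subrK.
(* A rank factorisation of t^n yields A B = 1, so B A is idempotent and K is its kernel. *)
have [r [al [be [albe beal]]]] := finite_coordinates f (finM isfin).
pose B := of_power Mn be.
have [A [AB Atop]] := split_power Mn albe.
have BA y : t ^+ n *: B (A y) = t ^+ n *: y.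
  (* The vector t^n y is in ker t, where A is [to_power] and the shift sum has a single term. *)
  rewrite -[LHS]linearZ -[X in B X]linearZ Atop; last by rewrite scalerA -exprS.
  rewrite /B of_powerK shift_sum_bottom; last by rewrite scalerA -exprS.
  exact: beal.
have BE z : B z = shift_sum x n (be \o @coef n _) z by [].
have {}AB z : A (B z) = z := AB z.
clearbody B; pose q : {linear M -> M} := B \o A.
have d_lin : linear (fun y => y - B (A y)).
  by move=> c y z; rewrite [A _]linearP [B _]linearP scalerBr opprD addrACA.
pose d := mk_linear d_lin.
have d_ker y : q (d y) = 0 by rewrite [LHS](linearB q) /= AB subrr.
exists 'I_r (kernel_module q) A B (kernel_lift d_ker) (kernel_inj q) (be \o
  @coef n _) => //.
- move=> z; apply: kernel_inj_injective; rewrite linear0.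
  transitivity (t ^+ n *: kernel_inj q z); first exact: linearZ.
  by rewrite -BA [B _](kernel_injP z) scaler0.
- by move=> y; rewrite kernel_liftK addrC subrK.
move=> _.
have ab z : kernel_lift d_ker (kernel_inj q z) = z.
  by apply: kernel_inj_injective; rewrite kernel_liftK /= [B _](kernel_injP z)
    subr0.
split=> //.
- by exists r, id; exists id.
- apply: (finite_dimensional_image (f := kernel_lift d_ker)); last exact: finM.
  by move=> z; exists (kernel_inj q z).
- by move=> z; apply: kernel_inj_injective;
  rewrite linear0 kernel_liftK /= AB subrr.
split=> // z; rewrite -[LHS]AB.
by rewrite [B _](kernel_injP z) linear0.
Qed.

End Decomposition.

(** * Decomposition of modules and vanishing of dual ghosts *)

Lemma sum_ordinal_bijective (I J : Type) r s (e : 'I_r -> I) (f : 'I_s -> J) :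
  bijective e -> bijective f -> exists q (h : 'I_q -> I + J), bijective h.
Proof.
move=> [e' eK e'K] [f' fK f'K]; exists (r + s)%N.
exists (fun u => match split u with inl i => inl (e i) | inr j => inr (f j)
  end).
exists (fun u => unsplit (match u with inl i => inl (e' i) | inr j => inr (f'
  j) end)).
  by move=> u; rewrite -[RHS]splitK; case: (split u) => i; rewrite ?eK ?fK.
by case=> i; rewrite unsplitK ?e'K ?f'K.
Qed.

Section Reindex.
Variables (R : pzRingType) (I J : Type) (X : I -> lmodType R) (e : J -> I).

Lemma reindex_product_linear :
  linear (fun z : product_module X => (fun j => z (e j)) : product_module (X \o
    e)).
Proof. by []. Qed.

Definition reindex_product := mk_linear reindex_product_linear.

Lemma eq_rect_linear i j (E : i = j) :
  linear (fun z : X i => eq_rect i (fun i => X i : Type) z j E).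
Proof. by case: j / E. Qed.

(** The factors depend on the index, so the inverse has to transport along the equations e (e' i) =
    i. *)
Lemma reindex_product_bij : bijective e ->
  exists f : {linear product_module (X \o e) -> product_module X},
    cancel reindex_product f /\ cancel f reindex_product.
Proof.
move=> [e' eK e'K].
pose f (z : product_module (X \o e)) : product_module X :=
  fun i => eq_rect (e (e' i)) (fun i => X i : Type) (z (e' i)) i (e'K i).
have f_lin : linear f.
  by move=> c y z; apply: functional_extensionality_dep => i;
    exact: eq_rect_linear.
exists (mk_linear f_lin); split=> z; apply: functional_extensionality_dep => i
  /=.
  have eq_rectE j l (E : j = l) : eq_rect j (fun i => X i : Type) (z j) l E = z
    l.
    by case: l / E.
  exact: eq_rectE.
rewrite /f; move: (e'K (e i)); rewrite eK => E.
by rewrite (Prop_irrelevance E erefl).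
Qed.

End Reindex.

Section StableFacts.
Variables (k : fieldType) (gT : finGroupType).
Local Notation kG := (group_algebra k gT).
Variable C : lmodType kG -> Prop.
Hypothesis C_kG : C kG^o.

Lemma stably_trivial0 (M N : lmodType kG) (f : M -> N) :
  (forall y, f y = 0) -> stably_trivial C f.
Proof.
move=> f0; exists kG^o, \0, \0; split=> //; exact: group_algebra_projective.
Qed.

Lemma linear_iso_stable (M N : lmodType kG) (f : {linear M ->
  N}) (g : {linear N -> M}) :
  cancel f g -> cancel g f -> stable_iso C M N.
Proof.
move=> fK gK; exists f, g; split; apply: stably_trivial0 => y /=.
  by rewrite fK subrr.
by rewrite gK subrr.
Qed.

Lemma stable_iso_linear_trans (M N L : lmodType kG) (f : {linear N -> L})
    (g : {linear L -> N}) :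
  cancel f g -> cancel g f -> stable_iso C M N -> stable_iso C M L.
Proof.
move=> fK gK [a [b [ba [P [u [v [CP prP E]]]]]]].
exists (f \o a), (b \o g); split.
  by case: ba => Q [u' [v' [CQ prQ E']]]; exists Q, u', v'; split=> // y /=;
    rewrite fK; exact: E'.
exists P, (u \o g), (f \o v); split=> // y /=.
by rewrite -E linearB /= gK.
Qed.

Lemma stable_iso_refl (M : lmodType kG) : stable_iso C M M.
Proof. exact: (linear_iso_stable (f := idfun) (g := idfun)). Qed.

(** Each component of s d is a trace, and the chosen k-linear maps assemble into one map to the
    product with trace s d. Since d = r s d - v u d, d is a trace too and factors through the free
    module on M. *)
Lemma dual_ghost_trivial (M N : lmodType kG) (I : Type) (X : I -> lmodType kG)
    (d : {linear M -> N}) :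
  C (free_module M) -> (forall i, is_suspension_of_k C (X i)) ->
  stable_retract C N (product_module X) -> dual_ghost C d -> stably_trivial C d.
Proof.
move=> CM XS [s [r [P [u [v [CP prP E]]]]]] d_ghost.
have comp_triv i : exists h : {linear kspace M -> kspace (X i)},
    forall y, s (d y) i = relative_trace h y.
  have si_lin : linear (fun y : N => s y i) by move=> c y z; rewrite linearP.
  have [j Xj] := XS i.
  exact: (stably_trivial_trace (d_ghost j _ Xj (mk_linear si_lin))).
pose h0 i := sval (cid (comp_triv i)).
have h0E i y : s (d y) i = relative_trace (h0 i) y := svalP (cid (comp_triv i))
  y.
pose h (y : kspace M) : kspace (product_module X) := fun i => h0 i y.
have h_lin : linear h.
  by move=> c y z; apply: functional_extensionality_dep => i;
    exact: (linearP (h0 i)).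
have sdE y : s (d y) = relative_trace h y.
  apply: functional_extensionality_dep => i; rewrite h0E /relative_trace.
  rewrite (big_morph (fun z : product_module X => z i) (id1 := 0) (op1 := +%R))
    //.
have [h2 h2E] : exists h2 : {linear kspace M -> kspace N},
    forall y, v (u (d y)) = relative_trace h2 y.
  apply: (@stably_trivial_trace _ _ C).
  by exists P, (u \o d), v.
apply: (trace_stably_trivial (h := (klin r \o mk_linear h_lin) \- h2) CM) => y.
have -> : d y = r (s (d y)) - v (u (d y)) by rewrite -E /= opprB addrC subrK.
rewrite sdE h2E /relative_trace linear_sum -sumrB; apply: eq_bigr => g _.
by rewrite linearZ -scalerBr.
Qed.

End StableFacts.

Section Classification.
Variables (p : nat) (k : fieldType) (gT : finGroupType) (x : gT).
Hypotheses (p_prime : prime p) (k_char : p \in [pchar k]).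
Hypotheses (x_central : x \in 'C([set: gT])%g) (x_order : #[x]%g = p).
Hypothesis x_gen : forall g, g \in <[x]>%g.
Local Notation kG := (group_algebra k gT).
Local Notation t := (aug_elt k x).
Local Notation triv := (trivial_module k gT).
Local Notation truncated := (truncated k x_central).
Local Notation truncated_product m := (product_module (fun i => truncated (m
  i))).

Variant decomposition (fin : Prop) n (M : lmodType kG) : Prop :=
  Decomposition (I : Type) (m : I -> nat)
    (A : {linear M -> truncated_product m}) (B : {linear truncated_product m ->
      M}) of
    (forall i, (0 < m i <= n)%N) & cancel A B &
    (fin -> (exists r (e : 'I_r -> I), bijective e) /\ cancel B A).

(** Induction on n: split off the copies of D_(n+1) and decompose the remainder K, which is killed
    by t^n. For n = 0 the module is zero and the index type is empty. *)
Lemma exists_decomposition (fin : Prop) n (M : lmodType kG) :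
  (fin -> finite_dimensional M) -> (forall y : M, t ^+ n *: y = 0) ->
  decomposition fin n M.
Proof.
elim: n M => [|n IHn] M finM Mn.
  exists 'I_0 (fun=> 0%N) \0 \0 => [[]//|y|_].
    by rewrite -[RHS]scale1r [RHS]Mn.
  split; first by exists 0%N, id; exists id.
  by move=> z; apply: functional_extensionality_dep; case.
have [I K A B a b l Kn _ BAba finK] := exists_splitting p_prime k_char
  x_central x_order x_gen finM Mn.
have [||J m A' B' m_le AK finJ] := IHn K => //; first by move=> /finK [].
pose m' (s : I + J) := match s with inl _ => n.+1 | inr j => m j end.
pose A1 (y : M) : truncated_product m' := fun s =>
  match s return truncated (m' s) with inl i => A y i | inr j => A' (a y) j end.
have A1_lin : linear A1.
  move=> c y z; apply: functional_extensionality_dep => -[i|j] /=.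
    by rewrite linearP.
  by rewrite [a _]linearP linearP.
pose inl_part (z : truncated_product m') : truncated_power k x_central n I :=
  fun i => z (inl i).
pose inr_part (z : truncated_product m') : truncated_product m :=
  fun j => z (inr j).
have B1_lin : linear (fun z => B (inl_part z) + b (B' (inr_part z))).
  have inlP : linear inl_part by [].
  have inrP : linear inr_part by [].
  move=> c y z; rewrite inlP inrP [B _]linearP [B' _]linearP [b _]linearP.
  by rewrite scalerDr addrACA.
exists (I + J)%type m' (mk_linear A1_lin) (mk_linear B1_lin).
- by case=> [i|j] //=; have /andP [-> /leqW] := m_le j.
- by move=> y; rewrite -[RHS]BAba -[in RHS](AK (a y)).
move=> isfin; have [[r [e eb]] _ AB aB [Ab ab]] := finK isfin.
have [[s [f fb]] B'K] := finJ isfin; split;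
  first exact: sum_ordinal_bijective eb fb.
move=> z; apply: functional_extensionality_dep => -[i|j] /=.
  by rewrite linearD AB Ab addr0.
by rewrite [a _]linearD aB ab add0r B'K.
Qed.

End Classification.

(** * The D_m that are suspensions, and stable decompositions *)

Section Sufficiency.
Variables (p : nat) (k : fieldType) (gT : finGroupType) (x : gT).
Hypotheses (p_prime : prime p) (k_char : p \in [pchar k]).
Hypotheses (x_central : x \in 'C([set: gT])%g) (x_order : #[x]%g = p).
Hypothesis x_gen : forall g, g \in <[x]>%g.
Local Notation kG := (group_algebra k gT).
Local Notation t := (aug_elt k x).
Local Notation triv := (trivial_module k gT).
Local Notation truncated := (truncated k x_central).
Local Notation truncated_product m := (product_module (fun i => truncated (m
  i))).
Local Notation dual_map := (dual_map p_prime k_char x_order x_gen).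

Variable C : lmodType kG -> Prop.
Hypotheses (C_kG : C kG^o) (C_free : forall M, C M -> C (free_module M)).
Hypotheses (C_triv : C triv) (C_truncated : forall m, (m <= p)%N ->
  C (truncated m)).

Let t_trivial (y : triv) : t *: y = 0.
Proof.
rewrite scalerBl scale1r; apply/eqP; rewrite subr_eq0; apply/eqP.
by apply: etrans (trivial_moduleZ _ _) _;
  rewrite augmentation_group_element mul1r.
Qed.

(** D_1 is the socle of kG, and the top coefficient identifies it with k. *)
Lemma truncated1_suspension : is_suspension_of_k C (truncated 1).
Proof.
exists (Posz 0); split=> /=; first exact/C_truncated/prime_gt0.
have f_lin : linear (fun y : truncated 1 => top_functional p k x (truncated_inj
  y) : triv).
  apply: (linear_commuting x_gen) => [c y z|y].
    by rewrite -linearP; congr (top_functional _ _ _ _);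
      exact: (linearP truncated_inj).
  by rewrite t_trivial [t *: y](truncated_scale (m := 1)) [truncated_inj
    0]linear0; exact: linear0.
have g_ker y : t ^+ 1 * (dual_map idfun y : kG) = 0.
  by rewrite -[LHS]linearZ t_trivial linear0.
apply: (linear_iso_stable C_kG (f := mk_linear f_lin) (g := truncated_lift
  x_central g_ker)).
  move=> y; apply: truncated_injective; rewrite truncated_liftK.
  apply/eqP; rewrite -subr_eq0; apply/eqP.
  apply: (top_eq0 p_prime k_char x_order x_gen).
    have dual0 c : t *: (dual_map idfun c : kG^o) = 0 by rewrite -[LHS]linearZ
      t_trivial linear0.
    rewrite scalerBr dual0 -[t *: truncated_inj y]linearZ [t *:
      y](truncated_scale (m := 1)).
    by rewrite linear0 addr0.
  by rewrite [LHS]linearB top_dual_map; exact: subrr.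
by move=> y; exact: top_dual_map.
Qed.

(** Since t^(p-1) a = augmentation(a) t^(p-1), the augmentation ideal is ker t^(p-1), so D_(p-1) is
    the syzygy of k for the cover kG -> k. *)
Lemma truncated_suspension : is_suspension_of_k C (truncated p.-1).
Proof.
have C1 : C (truncated p.-1) by exact/C_truncated/leq_pred.
exists (Posz 1); split=> //; exists triv, (truncated p.-1); split=> //.
- exact: stable_iso_refl.
- exists kG^o, (augmentation_map k gT), truncated_inj; split=> //.
  + exact: group_algebra_projective.
  + exact: augmentation_map_surjective.
  + exact: truncated_injective.
  have tg g : t ^+ p.-1 * g%:e = t ^+ p.-1.
    have /cycleP [i ->] := x_gen g.
    elim: i => [|i IHi]; first by rewrite expg0 group_element1 mulr1.
    rewrite expgS group_elementM mulrA -[x%:e](subrK 1) mulrDr mulr1.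
    by rewrite -exprSr prednK ?prime_gt0 // (aug_eltXp k_char) // add0r.
  have ta (a : kG) : t ^+ p.-1 * a = augmentation a *: t ^+ p.-1.
    rewrite {1}[a]group_algebra_sum mulr_sumr scaler_suml;
      apply: eq_bigr => g _.
    by rewrite -scalerAr tg.
  move=> a; split=> [a0|[y <-]].
    have a_ker : t ^+ p.-1 * a = 0.
      by rewrite ta (_ : augmentation a = 0) ?scale0r.
    by have [w ->] := group_algebra_exact p_prime k_char x_order (leq_pred p)
      a_ker;
       exists (truncated_cover k_char x_central x_order (leq_pred p) w).
  (* The coefficient of t^(p-1) at x^(p-1) is 1, so comparing coefficients there recovers the
     augmentation. *)
  have := truncated_inj0 y; rewrite ta => /ffunP /(_ (x ^+ p.-1)%g).
  rewrite !ffunE (aug_eltX_coef k p_prime x_order) //;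
    last by rewrite leqnn prednK ?prime_gt0 /=.
  by rewrite eqxx => <-; rewrite [RHS]mulr1.
- exact: stable_iso_refl.
Qed.

(** For n = p - 1 the map B is a shift sum of full length, hence stably trivial. The top layer
    therefore disappears stably, and only K, killed by t^(p-1), has to be decomposed. *)
Lemma stable_decomposition (fin : Prop) (M : lmodType kG) :
  (fin -> finite_dimensional M) -> C M ->
  exists (I : Type) (m : I -> nat),
  [/\ forall i, (0 < m i <= p.-1)%N, stable_retract C M (truncated_product m)
    & fin -> (exists r (e : 'I_r -> I), bijective e) /\
             stable_iso C M (truncated_product m)].
Proof.
move=> finM CM.
have Mp (y : M) : t ^+ p.-1.+1 *: y = 0 by exact: aug_elt_scale_p.
have [I K A B a b l Kn Bl BAba finK] :=
  exists_splitting p_prime k_char x_central x_order x_gen finM Mp.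
have [|J m A' B' m_le AK finJ] := exists_decomposition p_prime k_char x_central
    x_order x_gen (fin := fin) _ Kn; first by move=> /finK [].
have retr : stable_eq C ((b \o B') \o (A' \o a)) idfun.
  have [P [u [v [CP prP E]]]] := shift_sum_stably_trivial p_prime k_char
    x_order x_gen l (C_free CM).
  exists P, (u \o A), (\- v); split=> // y /=.
  by rewrite AK -E -Bl -[X in _ - X]BAba opprD addrCA subrr addr0.
exists J, m; split=> //; first by exists (A' \o a), (b \o B').
move=> isfin; have [_ _ _ _ [_ ab]] := finK isfin.
have [finiteJ BK] := finJ isfin; split=> //.
exists (A' \o a), (b \o B'); split=> //; apply: (stably_trivial0 C_kG) => z /=.
by rewrite ab BK subrr.
Qed.

Hypothesis p_le3 : (p <= 3)%N.

Lemma small_truncated_suspension m : (0 < m <= p.-1)%N ->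
  is_suspension_of_k C (truncated m).
Proof.
move=> m_le; have [->|m_neq] := eqVneq m p.-1;
  first exact: truncated_suspension.
have -> : m = 1%N by lia.
exact: truncated1_suspension.
Qed.

End Sufficiency.

(** * The theorem *)

Lemma exists_central_order (p : nat) (gT : finGroupType) :
  pgroup p [set: gT] -> [set: gT] <> 1%g ->
  exists2 x : gT, x \in 'C([set: gT])%g & #[x]%g = p.
Proof.
move=> pG ntG.
have Z_nt : 'Z([set: gT])%g != 1%g by apply/eqP => /(trivg_center_pgroup pG).
have [p_pr p_dvd _] := pgroup_pdiv (pgroupS (center_sub _) pG) Z_nt.
have [x /setIP [_ xC] xp] := Cauchy p_pr p_dvd.
by exists x.
Qed.

Section Obstructions.
Variables (p : nat) (k : fieldType) (gT : finGroupType) (x : gT).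
Hypotheses (p_prime : prime p) (k_char : p \in [pchar k]).
Hypotheses (x_central : x \in 'C([set: gT])%g) (x_order : #[x]%g = p).
Local Notation kG := (group_algebra k gT).
Local Notation t := (aug_elt k x).

(** Iterating t = t^2 c gives t = t^(n+1) c^n, which vanishes at n = p, although t is nonzero. *)
Lemma aug_elt_notin_square (c : kG) : t <> t ^+ 2 * c.
Proof.
move=> tE.
have tn n : t = t ^+ n.+1 * c ^+ n.
  elim: n => [|n IHn]; first by rewrite mulr1.
  transitivity (t ^+ n * (t ^+ 2 * c) * c ^+ n); first by rewrite -tE -exprSr.
  by rewrite mulrA -exprD addn2 -mulrA -exprS.
have t0 : t = 0 by rewrite (tn p) exprS (aug_eltXp k_char) // mulr0 mul0r.
have := congr1 (fun a : kG => a 1%g) t0; rewrite !ffunE eqxx.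
have [x1|_] := eqVneq 1%g x.
  by have := prime_gt1 p_prime; rewrite -x_order -x1 order1.
by rewrite sub0r => /eqP; rewrite oppr_eq0 oner_eq0.
Qed.

(** The sum of the coefficients over <x> is invariant under left multiplication by x, hence zero on
    t kG; on g - 1 it is -1. *)
Lemma group_element_notin_ideal (g : gT) (c : kG) : g \notin <[x]>%g ->
  g%:e - 1 <> t * c.
Proof.
move=> gx E; pose s (a : kG) : k := \sum_(y in <[x]>%g) a y.
have : s (g%:e - 1) = s (t * c) by rewrite E.
have sB a b : s (a - b) = s a - s b.
  by rewrite /s -sumrB; apply: eq_bigr => y _; rewrite !ffunE.
have xc y : (x%:e * c) y = c (x^-1 * y)%g.
  rewrite ffunE (bigD1 x) //= ffunE eqxx mul1r big1 ?addr0 // => z nz.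
  by rewrite ffunE (negbTE nz) mul0r.
have -> : s (t * c) = 0.
  rewrite mulrBl mul1r sB /s (reindex_inj (mulgI x)) /=.
  apply/eqP; rewrite subr_eq0; apply/eqP.
  by apply: eq_big => y; rewrite ?xc ?mulKg // groupMl // cycle_id.
rewrite sB -group_element1 /s big1 => [|y yx]; last first.
  by rewrite ffunE; case: eqP yx gx => // -> ->.
rewrite (bigD1 1%g) ?group1 //= ffunE eqxx big1 => [|y /andP [_ /negbTE ny]];
  last first.
  by rewrite ffunE ny.
by rewrite addr0 sub0r => /eqP; rewrite oppr_eq0 oner_eq0.
Qed.

End Obstructions.

Lemma not_C2_C3_obstruction (p : nat) (gT : finGroupType) (k : fieldType) :
  prime p -> pgroup p [set: gT] -> [set: gT] <> 1%g ->
  ~ ([set: gT] \isog [set: 'Z_2] \/ [set: gT] \isog [set: 'Z_3]) ->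
  exists (x : gT) (m : nat) (b : group_algebra k gT),
  [/\ x \in 'C([set: gT])%g, #[x]%g = p, (m <= p - m)%N,
      augmentation b = 0 & p \in [pchar k] ->
        forall c, b <> aug_elt k x ^+ m * c].
Proof.
move=> p_pr pG ntG not23; have [x xC xp] := exists_central_order pG ntG.
exists x.
have aug0 g : augmentation (g%:e - 1 : group_algebra k gT) = 0.
  have augB (a b : group_algebra k gT) : augmentation (a - b) = augmentation a
    - augmentation b.
    exact: (linearB (augmentation_map k gT)).
  by rewrite -group_element1 augB !augmentation_group_element subrr.
have [Gx|] := boolP ([set: gT] \subset <[x]>)%g; last first.
  case/subsetPn => g _ gx; exists 1%N, (g%:e - 1); split=> //.
    by move: (prime_gt1 p_pr); clear; lia.
  by move=> _ c; exact: group_element_notin_ideal.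
have G_card : #|[set: gT]| = p.
  have -> : [set: gT] = <[x]>%g by apply/eqP;
    rewrite finset.eqEsubset Gx finset.subsetT.
  exact: xp.
have G_cyclic : cyclic [set: gT] by apply: prime_cyclic; rewrite G_card.
have isogZ q : (1 < q)%N -> p = q -> [set: gT] \isog [set: 'Z_q].
  move=> q1 pq; rewrite isog_cyclic_card // cardsT card_ord Zp_cast // G_card
    pq eqxx andbT.
  by apply/cyclicP; exists Zp1; exact: Zp_cycle.
exists 2%N, (aug_elt k x); split=> //; first 1 last.
- exact: aug0.
- by move=> k_char c; exact: (aug_elt_notin_square p_pr k_char xp).
have p2 : p <> 2%N by move=> p2; apply: not23; left; exact: isogZ.
have p3 : p <> 3%N by move=> p3; apply: not23; right; exact: isogZ.
have p4 : p <> 4%N by move=> p4; rewrite p4 in p_pr.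
by move: (prime_gt1 p_pr) p2 p3 p4; clear; lia.
Qed.

Lemma C2_C3_generator (p : nat) (gT : finGroupType) :
  pgroup p [set: gT] -> [set: gT] <> 1%g ->
  [set: gT] \isog [set: 'Z_2] \/ [set: gT] \isog [set: 'Z_3] ->
  (p <= 3)%N /\ exists x : gT,
  [/\ x \in 'C([set: gT])%g, #[x]%g = p & forall g, g \in <[x]>%g].
Proof.
move=> pG ntG G23; have [x xC xp] := exists_central_order pG ntG.
have [p_pr p_dvd _] := pgroup_pdiv pG (introN eqP ntG).
have [q [q_pr q3 Gq]] : exists q, [/\ prime q, (q <= 3)%N & #|[set: gT]| = q].
  by case: G23 => /card_isog ->; [exists 2%N | exists 3%N];
    rewrite cardsT card_ord.
have pq : p = q by apply/eqP; rewrite -dvdn_prime2 // -Gq.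
split; first by rewrite pq.
exists x; split=> // g; have : <[x]>%g == [set: gT].
  by rewrite eqEcard finset.subsetT -[#|<[x]>%g|]/#[x]%g xp Gq pq leqnn.
by move/eqP => ->; rewrite inE.
Qed.

Theorem theorem3p2 (p : nat) (gT : finGroupType) (k : fieldType)
    (p_prime : prime p) (G_pgroup : pgroup p [set: gT])
    (G_nontrivial : [set: gT] <> 1%g) (k_char : p \in [pchar k]%R) :
  [<-> [set: gT] \isog [set: 'Z_2] \/ [set: gT] \isog [set: 'Z_3];
       no_nontrivial_dual_ghosts (@finite_dimensional k gT);
       no_nontrivial_dual_ghosts (@all_modules k gT);
       finite_products_of_suspensions (@finite_dimensional k gT);
       retracts_of_products_of_suspensions (@all_modules k gT)].
Proof.
set G23 := (_ \/ _).
have fd_kG := @finite_dimensional_group_algebra k gT.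
have fd_triv := @finite_dimensional_trivial k gT.
have fd_free := @finite_dimensional_free k gT.
(* Serves both categories: [fin] will be True for stmod and False for StMod. *)
have decompose (C : lmodType (group_algebra k gT) -> Prop) (fin : Prop) :
    G23 -> C (group_algebra k gT)^o -> (forall M, C M -> C (free_module M)) ->
    C (trivial_module k gT) -> (forall M, finite_dimensional M -> C M) ->
    forall M, (fin -> finite_dimensional M) -> C M ->
    exists (I : Type) (X : I -> lmodType (group_algebra k gT)),
    [/\ forall i, is_suspension_of_k C (X i),
      stable_retract C M (product_module X)
      & fin -> (exists r (e : 'I_r -> I), bijective e) /\
               stable_iso C M (product_module X)].
  move=> /(C2_C3_generator G_pgroup G_nontrivial) [p3 [x [xC xp x_gen]]] CkG
    Cfree Ctriv Cfd M finM CM.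
  have [I [m [m_le retr iso]]] := stable_decomposition p_prime k_char xC xp
    x_gen CkG Cfree finM CM.
  exists I, (fun i => truncated k xC (m i)); split=> // i.
  apply: (small_truncated_suspension p_prime k_char xp x_gen CkG Ctriv _ p3
    (m_le i)).
  by move=> j jp; apply: Cfd; exact: (finite_dimensional_truncated p_prime
    k_char xC xp jp).
have small_fd (G : G23) (M : lmodType (group_algebra k gT)) (M_fd :
  finite_dimensional M) :=
  decompose _ True G fd_kG fd_free fd_triv (fun M H => H) M (fun=> M_fd) M_fd.
have small_all (G : G23) (M : lmodType (group_algebra k gT)) :=
  decompose all_modules False G I (fun _ _ => I) I (fun _ _ => I) M
    (@False_rect _) I.
(* Each of the four conditions is compared directly with the first; the converse directions share
   the same obstruction module D_m. *)
have obstruct (Q : Prop) :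
    (forall (x : gT) (xC : x \in 'C([set: gT])%g) m b, #[x]%g = p ->
      (m <= p - m)%N ->
       augmentation b = 0 -> (forall c, b <> aug_elt k x ^+ m * c) ->
       finite_dimensional (truncated k xC m) -> ~ Q) -> Q -> G23.
  move=> nQ q; apply: contrapT => nG.
  have [x [m [b [xC xp m_le b0 bm]]]] := not_C2_C3_obstruction k p_prime
    G_pgroup G_nontrivial nG.
  apply: (nQ x xC m b xp m_le b0 (bm k_char)) q.
  exact: (finite_dimensional_truncated p_prime k_char xC xp (leq_trans m_le
    (leq_subr _ _))).
have H12 : G23 -> no_nontrivial_dual_ghosts (@finite_dimensional k gT).
  move=> G M N M_fd N_fd d; have [I [X [XS retr _]]] := small_fd G N N_fd.
  exact: dual_ghost_trivial (fd_free _ M_fd) XS retr.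
have H13 : G23 -> no_nontrivial_dual_ghosts (@all_modules k gT).
  move=> G M N _ _ d; have [J [X [XS retr _]]] := small_all G N.
  exact: (dual_ghost_trivial I XS retr).
have H14 : G23 -> finite_products_of_suspensions (@finite_dimensional k gT).
  move=> G M M_fd; have [J [X [XS _ /(_ I) [[r [e e_bij]] iso]]]] := small_fd G
    M M_fd.
  exists r, (X \o e); split=> [i|]; first exact: XS.
  have [f [fK Kf]] := reindex_product_bij X e_bij.
  exact: (stable_iso_linear_trans fK Kf iso).
have H15 : G23 -> retracts_of_products_of_suspensions (@all_modules k gT).
  by move=> G M _; have [J [X [XS retr _]]] := small_all G M; exists J, X.
have H21 : no_nontrivial_dual_ghosts (@finite_dimensional k gT) -> G23.
  apply: obstruct => x xC m b xp m_le b0 bm fd.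
  exact: (exists_nontrivial_dual_ghost p_prime k_char xp m_le b0 bm fd_kG fd).
have H31 : no_nontrivial_dual_ghosts (@all_modules k gT) -> G23.
  apply: obstruct => x xC m b xp m_le b0 bm fd.
  exact: (exists_nontrivial_dual_ghost (x_central := xC) p_prime k_char xp m_le
    b0 bm I I).
have H41 : finite_products_of_suspensions (@finite_dimensional k gT) -> G23.
  apply: obstruct => x xC m b xp m_le b0 bm fd /(_ _ fd) [r [X [XS iso]]].
  exact: (truncated_not_retract p_prime k_char xp m_le b0 bm XS
    (stable_iso_retract iso)).
have H51 : retracts_of_products_of_suspensions (@all_modules k gT) -> G23.
  apply: obstruct => x xC m b xp m_le b0 bm fd /(_ (truncated k xC m) I) [J [X
    [XS retr]]].
  exact: (truncated_not_retract p_prime k_char xp m_le b0 bm XS retr).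
by tfae; auto.
Qed.
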